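(* Let $S,B\subseteq([-1,1]\cup\{*\})^X$ be real-valued hypothesis classes. For $\eta_1,\eta_2,\beta,\delta\in(0,1/2)$, let $m:=\sup_{\theta\in\mathbb{R}}\mathsf{VC}(S^{(0)}_{\eta_1},B^{(\theta)}_{\eta_2})$. Then \[ \#\mathsf{CorM}(S,B,\beta+2\eta_1+2\eta_2,\delta)\le O\!\left(\frac{m}{\beta^4}\log_+^2\!\left(\frac m\beta\right)\log\!\left(\frac1{\eta_1}\right)+\frac1{\beta^4}\log\!\left(\frac1{\eta_1}\right)\log\!\left(\frac1\delta\right)+\frac1{\beta^2}\log\!\left(\frac1{\eta_2}\right)\right). \] Moreover, for every $\varepsilon\in(0,1/2)$, taking $\beta=\eta_1=\eta_2=\varepsilon/5$ in the definition of $m$, one has $m\le\mathsf{fat}_{\varepsilon/5}(S,B)$ and \[ \#\mathsf{CorM}(S,B,\varepsilon,\delta)\le O\!\left(\frac{m}{\varepsilon^4}\log_+^2\!\left(\frac m\varepsilon\right)\log\!\left(\frac1\varepsilon\right)+\frac1{\varepsilon^4}\log\!\left(\frac1\varepsilon\right)\log\!\left(\frac1\delta\right)\right). \]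
   Context: $X$ is a non-empty set; a real-valued (partial) hypothesis is $h:X\to[-1,1]\cup\{*\}$. Distributions are discrete. For $h$, a reference function $r:X\to\mathbb{R}$ and $\eta\ge0$, define the binary hypothesis $h^{(r)}_\eta(x)=1$ if $h(x)\ne*$ and $h(x)>r(x)+\eta$; $h^{(r)}_\eta(x)=-1$ if $h(x)\neq*$ and $h(x)<r(x)-\eta$; $h^{(r)}_\eta(x)=*$ otherwise. $H^{(r)}_\eta=\{h^{(r)}_\eta:h\in H\}$; for $\theta\in\mathbb{R}$, $H^{(\theta)}_\eta$ uses the constant function $r\equiv\theta$. A set $X'\subseteq X$ is shattered by a binary class $H$ if every $\xi:X'\to\{-1,1\}$ equals some $h\in H$ on $X'$; $\mathsf{VC}(S,B)$ (mutual VC dimension) is the sup of $|X'|$ over $X'$ shattered by both. $X'$ is $\eta$-fat shattered by $H$ if there is $r:X'\to\mathbb{R}$ such that for every $\xi:X'\to\{-1,1\}$ some $h\in H$ has $h(x)\ne*$ and $\xi(x)(h(x)-r(x))>\eta$ for all $x\in X'$; $\mathsf{fat}_\eta(S,B)$ is the sup of $|X'|$ over $X'$ that are $\eta$-fat shattered by both $S$ and $B$ (possibly with different reference functions). Generalized product: for $u_1\in\mathbb{R}$, $u_2\in[-1,1]\cup\{*\}$, $u_1\diamondsuit u_2=u_1u_2$ if $u_2\in[-1,1]$ and $=-|u_1|$ if $u_2=*$. Correlation maximization $\mathsf{CorM}_n(S,B,\varepsilon,\delta)$: the set of (possibly randomized) learners taking $n$ points in $X\times[-1,1]$ and outputting $f:X\to\{-1,1\}$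 such that for every distribution $\mu$ on $X\times[-1,1]$ for which some $s\in S$ has $\Pr_{x\sim\mu|_X}[s(x)\ne*]=1$ and $\mathbb{E}_\mu[y\mid x]=s(x)$, given $n$ i.i.d. samples, with probability $\ge1-\delta$, $\mathbb{E}_\mu[yf(x)]\ge\sup_{b\in B}\mathbb{E}_\mu[y\diamondsuit b(x)]-\varepsilon$. $\#\mathsf{CorM}$ is the least $n$ for which such a learner exists. $\log$ base 2, $\log_+(u)=\log\max\{2,u\}$; $O$ hides absolute constants. *)

(* Defs.v *)
From HB Require Import structures.
From mathcomp Require Import all_boot all_order all_algebra.
From mathcomp Require Import all_classical all_reals all_analysis.
From Stdlib Require List.
Import numFieldNormedType.Exports.
Set Implicit Arguments. Unset Strict Implicit. Unset Printing Implicit Defensive.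
Import Order.TTheory GRing.Theory Num.Theory.
Local Open Scope classical_set_scope.
Local Open Scope ring_scope.

Section Defs.
Variable R : realType.
Variable X : Type.

(* A real-valued partial hypothesis h : X -> [-1,1] \cup {star} is a function
   X -> option R (None stands for the star); a class is a set of such functions all of whose
   defined values lie in [-1,1]. *)
Definition real_valued_class (H : set (X -> option R)) : Prop :=
  forall h, H h -> forall x v, h x = Some v -> -1 <= v <= 1.

Definition sgnb (b : bool) : R := if b then 1 else -1.

Definition gprod (u1 : R) (u2 : option R) : R :=
  match u2 with Some v => u1 * v | None => - `|u1| end.

Definition binarize (r : X -> R) (eta : R) (h : X -> option R) : X -> option bool :=
  fun x => match h x with
           | Some v => if r x + eta < v then Some true
                       else if v < r x - eta then Some false else None
           | None => None
           end.

Definition bin_class (H : set (X -> option R)) (r : X -> R) (eta : R)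
  : set (X -> option bool) := [set binarize r eta h | h in H].

(* finite sets X' are represented by duplicate-free lists *)
Definition shatters (H : set (X -> option bool)) (X' : seq X) : Prop :=
  forall xi : X -> bool, exists2 h, H h & forall x, List.In x X' -> h x = Some (xi x).

Definition mutualVC (S B : set (X -> option bool)) : \bar R :=
  ereal_sup [set ((size X')%:R)%:E |
             X' in [set X' : seq X | List.NoDup X' /\ shatters S X' /\ shatters B X']].

Definition supVC (S B : set (X -> option R)) (eta1 eta2 : R) : \bar R :=
  ereal_sup [set mutualVC (bin_class S (fun _ => 0) eta1)
                          (bin_class B (fun _ => theta) eta2) | theta in [set: R]].

Definition fat_shatters (H : set (X -> option R)) (eta : R) (X' : seq X) : Prop :=
  exists r : X -> R, forall xi : X -> bool, exists2 h, H h &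
    forall x, List.In x X' -> exists v, h x = Some v /\ eta < sgnb (xi x) * (v - r x).

Definition fat (S B : set (X -> option R)) (eta : R) : \bar R :=
  ereal_sup [set ((size X')%:R)%:E |
             X' in [set X' : seq X | List.NoDup X' /\ fat_shatters S eta X' /\ fat_shatters B eta X']].

(* Discrete distributions on a countable support: weights w : nat -> R
   (nonnegative, summing to 1) on atoms indexed by nat. *)
Definition ddist (w : nat -> R) : Prop :=
  (forall i, 0 <= w i) /\ series w n @[n --> \oo] --> (1 : R).

(* mu on X x [-1,1] given by atoms p i = (x_i, y_i) with weights w i *)
Definition distXY (w : nat -> R) (p : nat -> X * R) : Prop :=
  ddist w /\ forall i, -1 <= (p i).2 <= 1.

Definition expect (w : nat -> R) (p : nat -> X * R) (g : X * R -> R) : R :=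
  limn (series (fun i => w i * g (p i))).

(* some s in S with Pr[s(x) <> *] = 1 and E[y | x] = s(x) (on the support) *)
Definition realizable (S : set (X -> option R)) (w : nat -> R) (p : nat -> X * R) : Prop :=
  exists2 s, S s & forall i, 0 < w i -> exists v, s (p i).1 = Some v /\
    expect w p (fun z => \1_[set (p i).1] z.1 * z.2)
    = v * expect w p (fun z => \1_[set (p i).1] z.1).

Definition corm_good (B : set (X -> option R)) (eps : R)
  (w : nat -> R) (p : nat -> X * R) (f : X -> bool) : bool :=
  (ereal_sup [set (expect w p (fun z => gprod z.2 (b z.1)))%:E | b in B] - eps%:E
    <= (expect w p (fun z => z.2 * sgnb (f z.1)))%:E)%E.

(* A randomized learner with n samples: a discrete seed distribution rho and
   a map A : seed -> sample -> (X -> {-1,1}).  Probability (over n i.i.d.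
   samples and the seed) that the output is good. *)
Definition success_prob (n : nat) (w : nat -> R) (p : nat -> X * R)
  (rho : nat -> R) (A : nat -> seq (X * R) -> X -> bool) (good : (X -> bool) -> bool)
  : \bar R :=
  \esum_(u in [set: n.-tuple nat * nat])
     ((\prod_(j <- u.1) w j) * rho u.2 * (good (A u.2 (map p u.1)))%:R)%:E.

Definition CorM_exists (n : nat) (S B : set (X -> option R)) (eps delta : R) : Prop :=
  exists (rho : nat -> R) (A : nat -> seq (X * R) -> X -> bool),
    ddist rho /\
    forall w p, distXY w p -> realizable S w p ->
      ((1 - delta)%:E <= success_prob n w p rho A (corm_good B eps w p))%E.

End Defs.

Definition log2 {R : realType} (x : R) : R := ln x / ln 2.
Definition log2p {R : realType} (x : R) : R := log2 (Num.max 2 x).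

(* Main.v *)
Require Import Defs.
From HB Require Import structures.
From mathcomp Require Import all_boot all_order all_algebra.
Set Implicit Arguments. Unset Strict Implicit. Unset Printing Implicit Defensive.
Import Order.TTheory GRing.Theory Num.Theory.

(** Fix a threshold [theta]. Where the binarizations of [s] at [0] and of [b] at [theta] agree, their
common value defines a partial binary hypothesis; the class of these has VC dimension at most [m],
since a set that it shatters is shattered by both binarized classes. Averaging the gain of such a
hypothesis over a uniform grid of thresholds recovers the correlation of [s] with [b], up to
[2 eta1 + 2 eta2 + 3 / G].

Halving over the patterns of the agreement class on [K] points makes at most [log2] of the number
of patterns mistakes, which by Sauer--Shelah is a small fraction of [K].  Drawing the points from
the empirical distribution, some slot and some [K] sample points give a predictor with small
empirical error on the domain of the agreement hypothesis.  Such predictors are described by [K]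
sample indices, a slot, [K] labels and a threshold, so there are few of them, and each depends on
few coordinates of the sample: a Chernoff bound that leaves these coordinates out controls all
empirical correlations uniformly.  The learner outputs the candidate of largest empirical
correlation. *)

(** * Shattering in finite set systems *)

Section SetSystems.
Variable T : finType.
Implicit Types (A C : {set T}) (F G : {set {set T}}).

Definition shattered_sets F : {set {set T}} :=
  [set A : {set T} | [forall D : {set T}, (D \subset A) ==> [exists C in F, C :&: A == D]]].

Lemma shattered_setsP F A :
  reflect (forall D : {set T}, D \subset A -> exists2 C, C \in F & C :&: A = D)
          (A \in shattered_sets F).
Proof.
rewrite inE; apply: (iffP forallP) => [h D sDA|h D].
  have /existsP [C /andP [CF /eqP e]] := implyP (h D) sDA.
  by exists C.
by apply/implyP => /h [C CF e]; apply/existsP; exists C; rewrite CF e eqxx.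
Qed.

Lemma shattered_setsS F G : F \subset G -> shattered_sets F \subset shattered_sets G.
Proof.
move=> sFG; apply/subsetP => A /shattered_setsP h; apply/shattered_setsP => D /h [C CF e].
by exists C => //; apply: (subsetP sFG).
Qed.

(* Pajor's form of the Sauer--Shelah lemma. *)
Lemma card_le_shattered F : (#|F| <= #|shattered_sets F|)%N.
Proof.
have [n] := ubnP #|F|; elim: n F => // n IH F; rewrite ltnS => leFn.
have [F1|] := leqP #|F| 1.
  have [->|[C CF]] := set_0Vmem F; first by rewrite cards0.
  apply: (leq_trans F1); rewrite card_gt0; apply/set0Pn; exists set0.
  apply/shattered_setsP => D; rewrite subset0 => /eqP ->.
  by exists C; rewrite // setI0.
case/card_gt1P => [C1 [C2 [C1F C2F neC]]].
have [x xC] : exists x, (x \in C1) != (x \in C2).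
  apply/existsP; rewrite -negb_forall; apply: contra neC => /forallP h.
  by apply/eqP/setP => x; apply/eqP.
(* Induction on the two nonempty halves of [F] cut by membership of a point [x] on which two members
   differ. *)
pose Fx (b : bool) := [set C in F | (x \in C) == b].
have FxF b : Fx b \subset F by apply/subsetP => C; rewrite inE => /andP [].
have cF : (#|F| = #|Fx true| + #|Fx false|)%N.
  rewrite -(cardsID [set C : {set T} | x \in C] F); congr (_ + _)%N; apply: eq_card => C;
    by rewrite !inE 1?andbC; case: (x \in C); rewrite ?andbF ?andbT.
have pos b : (0 < #|Fx b|)%N.
  rewrite card_gt0; apply/set0Pn.
  case: (eqVneq (x \in C1) b) => [e|ne]; first by exists C1; rewrite inE C1F e eqxx.
  by exists C2; rewrite inE C2F; move: xC ne; case: (x \in C1); case: (x \in C2); case: b.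
have lt b : (#|Fx b| < n)%N.
  apply: leq_trans leFn; rewrite cF.
  by case: b; [rewrite -addn1 leq_add2l | rewrite -add1n leq_add2r].
(* Membership of [x] is constant on each half, so a set shattered by a half cannot contain [x]. *)
have xN b A : A \in shattered_sets (Fx b) -> x \notin A.
  move=> /shattered_setsP h; apply/negP => xA.
  have [C] := h (if b then set0 else A) ltac:(by case: b {h}; rewrite ?sub0set ?subxx).
  rewrite inE => /andP [_ /eqP xCb] /setP /(_ x).
  by rewrite inE xCb xA; case: b {h xCb}; rewrite ?inE ?xA.
rewrite cF; apply: leq_trans (leq_add (IH _ (lt true)) (IH _ (lt false))) _.
rewrite -cardsUI.
set U := _ :|: _; set V := _ :&: _.
have sU : U \subset shattered_sets F.
  by rewrite subUset !shattered_setsS.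
have cV : #|V| = #|[set x |: A | A in V]|.
  rewrite card_in_imset // => A B /setIP [hA _] /setIP [hB _] e.
  by rewrite -(setU1K (xN _ _ hA)) e setU1K ?(xN _ _ hB).
(* A set shattered by both halves would be counted twice in the union; adding [x] to it gives
   another set shattered by [F], and these are new because members of [U] miss [x]. *)
have sV : [set x |: A | A in V] \subset shattered_sets F.
  apply/subsetP => _ /imsetP [A /setIP [At Af] ->]; apply/shattered_setsP => D sD.
  have xA := xN _ _ At.
  have sDA : D :\ x \subset A.
    by apply/subsetP => y; rewrite !inE => /andP [yx /(subsetP sD)]; rewrite !inE (negbTE yx).
  have [C] : exists2 C, C \in Fx (x \in D) & C :&: A = D :\ x.
    by case: (x \in D); [move: At | move: Af] => /shattered_setsP; apply.
  rewrite inE => /andP [CF /eqP xCD] e; exists C => //.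
  apply/setP => y; rewrite !inE; case: (eqVneq y x) => [->|yx] /=; first by rewrite andbT.
  by move/setP: e => /(_ y); rewrite !inE yx.
rewrite cV -cardsUI (_ : U :&: _ = set0) ?cards0 ?addn0; last first.
  apply/setP => A; rewrite inE in_set0; apply/negP => /andP [hU /imsetP [B _ e]].
  by case/setUP: hU => /xN; rewrite e !inE eqxx.
by apply: subset_leq_card; rewrite subUset sU.
Qed.

End SetSystems.

(** * The halving algorithm and its mistake bound *)

Section Halving.
Variable K : nat.
Implicit Types (P : {set {set 'I_K}}) (A C : {set 'I_K}).

Definition version P A (t : nat) : {set {set 'I_K}} :=
  [set C in P | [forall j : 'I_K, (j < t)%N ==> ((j \in C) == (j \in A))]].

(** Majority vote of the version space; a tie predicts [false]. *)
Definition predict P A (t : 'I_K) : bool :=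
  (#|[set C in version P A t | t \notin C]| < #|[set C in version P A t | t \in C]|)%N.

(** The vote at [t] reads only the labels before [t], so the label of the query itself never
    enters. *)
Lemma eq_predict P A A' (t : 'I_K) :
  (forall j : 'I_K, (j < t)%N -> (j \in A) = (j \in A')) -> predict P A t = predict P A' t.
Proof.
move=> h; have -> // : predict P A t = predict P A' t.
rewrite /predict (_ : version P A t = version P A' t) //.
apply/setP => C; rewrite !inE; congr andb; apply: eq_forallb => j.
by case: ltnP => //= /h ->.
Qed.

Lemma versionS P A (t : 'I_K) :
  version P A t.+1 = [set C in version P A t | (t \in C) == (t \in A)].
Proof.
apply/setP => C; rewrite !inE -andbA; congr andb.
apply/forallP/andP => [h|[/forallP h e] j].
  split; last by have := h t; rewrite ltnSn.
  by apply/forallP => j; apply/implyP => jt; have := h j; rewrite ltnS (ltnW jt).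
rewrite ltnS leq_eqVlt; apply/implyP => /orP [/eqP/val_inj -> //|jt].
by have := h j; rewrite jt.
Qed.

(** A mistake means that at least half of the version space voted against [A], and those voters are
    removed. *)
Lemma halving_step P A (t : 'I_K) :
  (2 ^ (predict P A t != (t \in A)) * #|version P A t.+1| <= #|version P A t|)%N.
Proof.
have cV : (#|[set C in version P A t | t \in C]| + #|[set C in version P A t | t \notin C]|
          = #|version P A t|)%N.
  rewrite -(cardsID [set C : {set 'I_K} | t \in C] (version P A t)).
  by congr (_ + _)%N; apply: eq_card => C; rewrite !inE // andbC.
rewrite versionS /predict -cV.
have [tA|tA] := boolP (t \in A).
  rewrite (_ : [set C in _ | _ == true] = [set C in version P A t | t \in C]); last first.
    by apply/setP => C; rewrite !inE eqb_id.
  by case: ltnP => h /=; rewrite ?mul1n ?leq_addr // expn1 mul2n -addnn leq_add2l.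
rewrite (_ : [set C in _ | _ == false] = [set C in version P A t | t \notin C]); last first.
  by apply/setP => C; rewrite !inE eqbF_neg.
by case: ltnP => h /=; rewrite ?mul1n ?leq_addl // expn1 mul2n -addnn leq_add2r ltnW.
Qed.

(** The steps multiply, and [A] never leaves the version space, so its final size is at least
    one. *)
Lemma halving_mistakes P A :
  A \in P -> (2 ^ (\sum_(t < K) (predict P A t != (t \in A))) <= #|P|)%N.
Proof.
move=> AP.
have step k : (k <= K)%N ->
    (2 ^ (\sum_(t < K | (t < k)%N) (predict P A t != (t \in A)))
      * #|version P A k| <= #|P|)%N.
  elim: k => [_|k IH ltk].
    by rewrite big_pred0 // mul1n subset_leq_card //; apply/subsetP => C; rewrite inE => /andP[].
  apply: leq_trans (IH (ltnW ltk)).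
  rewrite (bigD1 (Ordinal ltk)) /=; last exact: ltnSn.
  rewrite (eq_bigl (fun t : 'I_K => (t < k)%N)); last first.
    by move=> t; rewrite ltnS -val_eqE /= andbC ltn_neqAle.
  by rewrite expnD mulnAC [X in (_ <= X)%N]mulnC leq_mul2r (halving_step P A (Ordinal ltk)) orbT.
have := step K (leqnn K); rewrite (eq_bigl xpredT) ?[X in (X * _)%N]/=; last first.
  by move=> t; rewrite ltn_ord.
apply: leq_trans; rewrite leq_pmulr // card_gt0; apply/set0Pn; exists A.
by rewrite inE AP; apply/forallP => j; rewrite eqxx implybT.
Qed.

End Halving.

From mathcomp Require Import all_classical all_reals all_analysis.
From mathcomp Require Import lra ring zify.
Import Order.TTheory GRing.Theory Num.Theory.
Import numFieldNormedType.Exports.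
Local Open Scope classical_set_scope.
Local Open Scope ring_scope.

(** * Weighted counting of small sets, and lists without duplicates *)

Lemma sum_exp_card (R : comNzRingType) (I : finType) (q : R) :
  \sum_(A : {set I}) q ^+ #|A| = (1 + q) ^+ #|I|.
Proof.
have <- : \prod_(i : I) (q + 1) = (1 + q) ^+ #|I| by rewrite prodr_const addrC.
rewrite bigA_distr; apply: eq_bigr => A _.
by rewrite -prodr_const big_mkcond.
Qed.

(** Give each set [A] the weight [q ^+ #|A|]. The total weight is [(1 + q) ^+ #|I|], and as [q <= 1]
    a set of size at most [m] weighs at least [q ^+ m]. This replaces the sum of binomial
    coefficients. *)
Lemma card_small_sets (R : numDomainType) (I : finType) (F : {set {set I}}) (m : nat) (q : R) :
  0 <= q <= 1 -> (forall A, A \in F -> (#|A| <= m)%N) ->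
  #|F|%:R * q ^+ m <= (1 + q) ^+ #|I|.
Proof.
move=> /andP [q0 q1] h; rewrite -sum_exp_card mulr_natl -sumr_const.
rewrite [leRHS](bigID (mem F)) /= -[leLHS]addr0 lerD ?sumr_ge0 //; last first.
  by move=> A _; apply: exprn_ge0.
by apply: ler_sum => A AF; apply: ler_wiXn2l => //; apply: h.
Qed.

Lemma In_map (I : eqType) (Y : Type) (f : I -> Y) (s : seq I) (y : Y) :
  List.In y (map f s) <-> exists2 i, i \in s & y = f i.
Proof.
elim: s => [|i s IH] /=; first by split => // -[].
split=> [[<-|/IH [j js ->]]|[j]].
- by exists i; rewrite // mem_head.
- by exists j; rewrite // in_cons js orbT.
- rewrite in_cons => /orP [/eqP -> ->|js e]; first by left.
  by right; apply/IH; exists j.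
Qed.

Lemma NoDup_map (I : eqType) (Y : Type) (f : I -> Y) (s : seq I) :
  uniq s -> {in s &, injective f} -> List.NoDup (map f s).
Proof.
elim: s => [|i s IH] /=; first by move=> _ _; constructor.
case/andP => iNs us inj; constructor.
  case/In_map => j js e; move: iNs; rewrite (inj i j) ?js ?mem_head //.
  by rewrite in_cons js orbT.
by apply: IH => // j k js ks; apply: inj; rewrite in_cons ?js ?ks orbT.
Qed.

(** * Patterns of a partial class and the transductive predictor *)

Section Patterns.
Variables (X : Type) (H : set (X -> option bool)) (K : nat).
Implicit Types (z : 'I_K -> X) (t : 'I_K).

(** Only hypotheses defined at every point leave a pattern, recorded as the set of indices labelled
    [true]. *)
Definition patterns z : {set {set 'I_K}} :=
  finset.finset (fun C : {set 'I_K} =>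
    `[< exists2 h, H h & forall j, h (z j) = Some (j \in C) >]).

Lemma patternsP z (C : {set 'I_K}) :
  C \in patterns z <-> exists2 h, H h & forall j, h (z j) = Some (j \in C).
Proof. by rewrite inE; split => /asboolP. Qed.

(** The points may repeat, but a shattered index set holds each point once: the pattern separating
    two indices of the same point would give that point two labels. *)
Lemma shattered_patterns z (A : {set 'I_K}) :
  A \in shattered_sets (patterns z) ->
  List.NoDup (map z (enum A)) /\ shatters H (map z (enum A)).
Proof.
move=> /shattered_setsP h; split.
  apply: NoDup_map; rewrite ?enum_uniq // => i j; rewrite !mem_enum => iA jA e.
  have [C /patternsP [g _ gC] /finset.setP eC] := h [set i]%SET ltac:(by rewrite finset.sub1set).
  apply/eqP; have := eC j; have := eC i.
  rewrite !finset.in_set1 !finset.in_setI iA jA eqxx !andbT (eq_sym i) => iC <-.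
  by have := gC j; rewrite -e gC iC => -[].
move=> xi.
have [C /patternsP [g Hg gC] /finset.setP eC] :=
  h (A :&: finset.finset (fun j => xi (z j)))%SET (finset.subsetIl _ _).
exists g => // x /In_map [j]; rewrite mem_enum => jA ->.
by rewrite gC; have := eC j; rewrite !finset.in_setI jA andbT !inE => ->.
Qed.

Lemma card_patterns (R : numDomainType) (q : R) (m : nat) z :
  (forall s : seq X, List.NoDup s -> shatters H s -> (size s <= m)%N) ->
  0 <= q <= 1 -> #|patterns z|%:R * q ^+ m <= (1 + q) ^+ K.
Proof.
move=> vc q01; have := q01 => /andP [q0 q1].
have h A : A \in shattered_sets (patterns z) -> (#|A| <= m)%N.
  move=> /shattered_patterns [nd sh]; have := vc _ nd sh.
  by rewrite size_map -cardE.
have := card_small_sets q01 h; rewrite card_ord; apply: le_trans.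
by apply: ler_wpM2r; rewrite ?exprn_ge0 // ler_nat card_le_shattered.
Qed.

Definition upd z t (x : X) : 'I_K -> X := fun j => if j == t then x else z j.

(* The transductive halving predictor on [K] points whose [t]-th one is the query. *)
Definition halving_predictor z (lab : {set 'I_K}) t (x : X) : bool :=
  predict (patterns (upd z t x)) lab t.

Definition label_set (a : X -> option bool) z : {set 'I_K} :=
  finset.finset (fun j => a (z j) == Some true).

Definition halving_error (a : X -> option bool) z t (x : X) : bool :=
  (a x != None) && (a x != Some (halving_predictor z (label_set a z) t x)).

Lemma label_set_mem (a : X -> option bool) z :
  H a -> (forall j, a (z j) != None) -> label_set a z \in patterns z.
Proof.
move=> Ha ha; apply/patternsP; exists a => // j.
by rewrite inE; case: (a (z j)) (ha j) => [[]|].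
Qed.

Lemma upd_id z t : upd z t (z t) = z.
Proof. by apply/funext => j; rewrite /upd; case: eqP => // ->. Qed.

(** The predictor overwrites slot [t] by the query and reads only the labels of earlier slots. The
    error is thus independent of the [t]-th point, which can be resampled. *)
Lemma halving_error_upd a z t x x' :
  halving_error a (upd z t x') t x = halving_error a z t x.
Proof.
rewrite /halving_error /halving_predictor.
have -> : upd (upd z t x') t x = upd z t x.
  by apply/funext => j; rewrite /upd; case: eqP.
rewrite (@eq_predict _ _ _ (label_set a z)) // => j jt.
by rewrite !inE /upd -val_eqE /= ltn_eqF.
Qed.

Lemma halving_errors a z :
  H a -> (forall j, a (z j) != None) ->
  (2 ^ (\sum_(t < K) halving_error a z t (z t)) <= #|patterns z|)%N.
Proof.
move=> Ha ha; apply: leq_trans (halving_mistakes (label_set_mem Ha ha)).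
rewrite leq_exp2l // leq_sum // => t _.
rewrite /halving_error /halving_predictor upd_id ha andTb !inE.
by case: (a (z t)) (ha t) => // b _; case: b; case: predict.
Qed.

End Patterns.

(** * Finite product weights and resampling of one coordinate *)

Section ProductWeights.
Variables (R : realType) (J I : finType) (w : I -> R).
Implicit Types (u : {ffun J -> I}) (j : J) (i : I).

Definition prodw u : R := \prod_j w (u j).

Definition setf u j i : {ffun J -> I} := [ffun k => if k == j then i else u k].

Lemma sum_prodw : \sum_u prodw u = (\sum_i w i) ^+ #|J|.
Proof. by rewrite -prodr_const bigA_distr_bigA. Qed.

Lemma setfE u j i : setf u j i j = i.
Proof. by rewrite ffunE eqxx. Qed.

Lemma setf_neq u j i k : k != j -> setf u j i k = u k.
Proof. by rewrite ffunE => /negbTE ->. Qed.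

Lemma prodw_setf u j i : prodw (setf u j i) * w (u j) = prodw u * w i.
Proof.
rewrite /prodw (bigD1 j) //= setfE [in RHS](bigD1 j) //=.
rewrite (eq_bigr (fun k => w (u k))); first by rewrite mulrC mulrA mulrAC.
by move=> k kj; rewrite setf_neq.
Qed.

(** Exchanging coordinate [j] with a fresh index is a weight-preserving involution on pairs. The
    total mass appears as a factor because the weights need not sum to one. *)
Lemma sum_resample j (F : {ffun J -> I} -> R) :
  \sum_u prodw u * (\sum_i w i * F (setf u j i)) = (\sum_i w i) * \sum_u prodw u * F u.
Proof.
pose swap (p : {ffun J -> I} * I) := (setf p.1 j p.2, p.1 j).
have swapK : involutive swap.
  move=> [u i]; rewrite /swap /= setfE; congr (_, _).
  by apply/ffunP => k; rewrite !ffunE; case: eqP => [->|].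
transitivity (\sum_p prodw p.1 * w p.2 * F p.1); last first.
  rewrite mulr_sumr -(pair_big xpredT xpredT (fun u i => prodw u * w i * F u)) /=.
  by apply: eq_bigr => u _; rewrite mulr_suml; apply: eq_bigr => i _; rewrite mulrCA mulrA.
rewrite (reindex swap) /=; last by exists swap => p _; apply: swapK.
rewrite -(pair_big xpredT xpredT (fun u i => prodw (setf u j i) * w (u j) * F (setf u j i))) /=.
apply: eq_bigr => u _; rewrite mulr_sumr; apply: eq_bigr => i _.
by rewrite prodw_setf mulrA.
Qed.

Hypothesis w_ge0 : forall i, 0 <= w i.

Lemma prodw_ge0 u : 0 <= prodw u.
Proof. exact: prodr_ge0. Qed.

Lemma prodw_gt0 u : 0 < prodw u -> forall j, 0 < w (u j).
Proof.
move=> h j; rewrite lt_neqAle w_ge0 andbT; apply/eqP => e.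
by move: h; rewrite /prodw (bigD1 j) //= -e mul0r ltxx.
Qed.

End ProductWeights.

(** * A Chernoff bound for functions depending on few sample coordinates *)

Lemma expR_le_quad (R : realType) (t : R) : t <= 1 / 2 -> expR t <= 1 + t + 2 * t ^+ 2.
Proof.
move=> t2; have := expR_ge1Dx (- t); rewrite expRN => h.
have e0 := expR_gt0 t.
have h1 : (1 - t) * expR t <= 1 by rewrite -ler_pdivlMr // mul1r.
(* The right-hand side equals [1 + t ^+ 2 * (1 - 2 * t)]. *)
have h2 : 1 <= (1 - t) * (1 + t + 2 * t ^+ 2) by nra.
by rewrite -(@ler_pM2l _ (1 - t)); nra.
Qed.

Section Concentration.
Variables (R : realType) (J I : finType) (w : I -> R) (lam : R).
Variables (g : {ffun J -> I} -> I -> R) (D : {set J}).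
Hypothesis w_ge0 : forall i, 0 <= w i.
Hypothesis w_le1 : \sum_i w i <= 1.
Hypothesis lam_gt0 : 0 < lam.
Hypothesis lam_le : lam <= 1 / 4.
Hypothesis w_large : 1 - lam / 2 <= \sum_i w i.
Hypothesis g_le1 : forall u i, `|g u i| <= 1.
Hypothesis g_setf : forall u j i i', j \notin D -> g (setf u j i) i' = g u i'.

Definition mean (u : {ffun J -> I}) : R := \sum_i w i * g u i.

Lemma mean_setf u j i : j \notin D -> mean (setf u j i) = mean u.
Proof. by move=> jD; apply: eq_bigr => k _; rewrite g_setf. Qed.

Lemma mean_le1 u : `|mean u| <= 1.
Proof.
apply: le_trans (ler_norm_sum _ _ _) _; apply: le_trans w_le1.
apply: ler_sum => i _; rewrite normrM ger0_norm //.
by rewrite ler_piMr.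
Qed.

Let c u i := g u i - mean u.

Lemma centered_bounds u i : -2 <= c u i <= 2.
Proof.
rewrite /c; have := g_le1 u i; have := mean_le1 u; rewrite !ler_norml.
by move=> /andP [? ?] /andP [? ?]; apply/andP; split; lra.
Qed.

(** As [c u i] is at most [2] in absolute value, the quadratic term is at most [8 * lam ^+ 2]. With
    mass [S] possibly below one, centering leaves the linear term [lam * (1 - S) * mean u], which
    [w_large] bounds by [S * lam ^+ 2]; hence the [9]. *)
Lemma mgf_atom u : \sum_i w i * expR (lam * c u i) <= (\sum_i w i) * expR (9 * lam ^+ 2).
Proof.
set S := \sum_i w i.
have h1 : \sum_i w i * expR (lam * c u i) <= \sum_i w i * (1 + lam * c u i + 8 * lam ^+ 2).
  apply: ler_sum => i _; apply: ler_wpM2l => //.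
  have /andP [c1 c2] := centered_bounds u i.
  have l0 := lam_gt0; have l4 := lam_le.
  have hc : lam * c u i <= lam * 2 by rewrite ler_pM2l.
  apply: le_trans (expR_le_quad _) _; first by lra.
  have c4 : (c u i) ^+ 2 <= 4 by move: c1 c2; move: (c u i) => x; nra.
  rewrite exprMn; have : lam ^+ 2 * c u i ^+ 2 <= lam ^+ 2 * 4.
    by apply: ler_wpM2l => //; apply: sqr_ge0.
  by lra.
apply: (le_trans h1).
have -> : \sum_i w i * (1 + lam * c u i + 8 * lam ^+ 2)
        = S * (1 + 8 * lam ^+ 2) + lam * (1 - S) * mean u.
  rewrite [in X in _ + X]mulrAC -mulrA mulrBr mulr1 [mean u * S]mulrC.
  rewrite {1}/mean mulrBr mulr_sumr /S !mulr_suml mulr_sumr -sumrB -big_split /=.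
  by apply: eq_bigr => i _; rewrite /c; ring.
have /andP [m1 m2] : -1 <= mean u <= 1 by rewrite -ler_norml mean_le1.
have S1 : S <= 1 := w_le1.
have S2 : 1 - lam / 2 <= S := w_large.
have h2 : lam * (1 - S) * mean u <= S * lam ^+ 2.
  have l0 := lam_gt0; have l4 := lam_le.
  apply: (@le_trans _ _ (lam * (1 - S))); last first.
    have : lam * (1 - S) <= lam * (lam / 2) by rewrite ler_pM2l //; lra.
    have : 1 / 2 * lam ^+ 2 <= S * lam ^+ 2 by rewrite ler_wpM2r ?sqr_ge0 //; lra.
    by rewrite expr2; lra.
  by rewrite ler_piMr // mulr_ge0 ?subr_ge0 // ltW.
apply: (@le_trans _ _ (S * (1 + 9 * lam ^+ 2))); first by lra.
by apply: ler_wpM2l; [have := lam_le; lra | exact: expR_ge1Dx].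
Qed.

(** Coordinates outside [D] change neither [g] nor [mean], so they are integrated out one at a time
    by resampling. *)
Lemma mgf_sum (E : {set J}) :
  (forall j, j \in E -> j \notin D) ->
  \sum_u prodw w u * expR (lam * \sum_(j in E) c u (u j)) <= expR (9 * lam ^+ 2) ^+ #|E|.
Proof.
have l4 := lam_le; have S0 : 0 < \sum_i w i by apply: lt_le_trans w_large; lra.
have [n] := ubnP #|E|; elim: n E => // n IH E; rewrite ltnS => lEn dED.
have [E0|[j jE]] := finset.set_0Vmem E.
  rewrite E0 finset.cards0 expr0; under eq_bigr do rewrite finset.big_set0 mulr0 expR0 mulr1.
  by rewrite sum_prodw exprn_ile1 // ltW.
have jD := dED _ jE.
have cardE : #|E| = #|E :\ j|%SET.+1 by rewrite (finset.cardsD1 j) jE.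
rewrite -(ler_pM2l S0) -(sum_resample w j).
pose E' := (E :\ j)%SET.
have key u : \sum_i w i * expR (lam * \sum_(k in E) c (setf u j i) (setf u j i k))
   = expR (lam * \sum_(k in E') c u (u k)) * \sum_i w i * expR (lam * c u i).
  rewrite mulr_sumr; apply: eq_bigr => i _; rewrite (finset.big_setD1 j) //= setfE.
  rewrite (eq_bigr (fun k => c u (u k))); last first.
    move=> k; rewrite finset.in_setD1 => /andP [kj _].
    by rewrite /c g_setf // mean_setf // setf_neq.
  rewrite /E' mulrDr expRD {1}/c g_setf // mean_setf // -/(c u i).
  by rewrite [RHS]mulrCA; congr (_ * _); rewrite mulrC.
under eq_bigr do rewrite key mulrA.
apply: (@le_trans _ _ (\sum_u prodw w u * expR (lam * \sum_(k in E') c u (u k))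
     * ((\sum_i w i) * expR (9 * lam ^+ 2)))).
  apply: ler_sum => u _; apply: ler_wpM2l; last exact: mgf_atom.
  by rewrite mulr_ge0 ?expR_ge0 ?prodw_ge0.
rewrite -mulr_suml mulrC -mulrA ler_pM2l // cardE [leRHS]exprS ler_pM2l ?expR_gt0 //.
apply: IH; first by rewrite -cardE.
by move=> k; rewrite finset.in_setD1 => /andP [_ /dED].
Qed.

(* The at most [k] coordinates in [D] contribute at most [2 k] to the centered sum. *)
Lemma concentration (gam : R) (k : nat) :
  0 <= gam -> (#|D| <= k)%N -> lam = gam / 18 ->
  \sum_u prodw w u * ((#|J|%:R * (mean u + gam) < \sum_j g u (u j))%R)%:R
    <= expR (k%:R - gam ^+ 2 * #|J|%:R / 36).
Proof.
move=> gam0 Dk elam.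
pose E := (~: D)%SET.
have dED j : j \in E -> j \notin D by rewrite finset.in_setC.
have := mgf_sum dED; set M := \sum_u _; set N : R := #|J|%:R => hM.
have hM' : M <= expR (9 * lam ^+ 2 * N).
  apply: (le_trans hM); rewrite -expRM_natr ler_expR; apply: ler_wpM2l.
    by rewrite mulr_ge0 // sqr_ge0.
  by rewrite ler_nat max_card.
(* Markov's inequality: on the event, the centered sum over [E] exceeds [N * gam - 2 * k]. The
   choice [lam = gam / 18] minimizes [9 * lam ^+ 2 - lam * gam], with value [- gam ^+ 2 / 36]. *)
apply: (@le_trans _ _ (M * expR (2 * lam * k%:R - lam * N * gam))); last first.
  apply: le_trans (ler_wpM2r (expR_ge0 _) hM') _.
  rewrite -expRD ler_expR elam.
  have k0 : 0 <= k%:R :> R by [].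
  have N0 : 0 <= N by [].
  have g1 : gam <= 9 by have := lam_le; lra.
  have : gam * k%:R <= 9 * k%:R by nra.
  by rewrite !expr2; lra.
rewrite /M mulr_suml; apply: ler_sum => u _; rewrite -mulrA; apply: ler_wpM2l.
  exact: prodw_ge0.
case: ltP => h; last by rewrite mulr_ge0 ?expR_ge0.
rewrite -expRD -[leLHS]expR0 ler_expR.
have e : \sum_j g u (u j) = N * mean u + \sum_(j in E) c u (u j) + \sum_(j in D) c u (u j).
  rewrite -addrA [X in _ + X]addrC.
  have -> : \sum_(j in D) c u (u j) + \sum_(j in E) c u (u j) = \sum_j c u (u j).
    rewrite [RHS](bigID (mem D)) /=; congr (_ + _).
    by apply: eq_bigl => j; rewrite finset.in_setC.
  rewrite /c sumrB sumr_const /N mulr_natl; lra.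
have hD : \sum_(j in D) c u (u j) <= 2 * k%:R.
  apply: (@le_trans _ _ (\sum_(j in D) 2)).
    by apply: ler_sum => j _; have /andP [] := centered_bounds u (u j).
  by rewrite sumr_const -[2 *+ _]mulr_natr ler_pM2l // ler_nat.
move: h; rewrite e mulrDr => h.
have l0 := ltW lam_gt0.
have : 0 <= lam * (\sum_(j in E) c u (u j) + 2 * k%:R - N * gam).
  by apply: mulr_ge0 => //; lra.
by lra.
Qed.

End Concentration.

(** * A halving predictor with small weighted error *)

Section WeakLearner.
Variables (R : realType) (X : Type) (H : set (X -> option bool)) (K m : nat).
Variables (I : finType) (i0 : I) (w : I -> R) (xs : I -> X) (a : X -> option bool) (gam : R).
Hypothesis H_vc : forall s : seq X, List.NoDup s -> shatters H s -> (size s <= m)%N.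
Hypothesis w_ge0 : forall i, 0 <= w i.
Hypothesis Ha : H a.
Hypothesis w_def : forall i, 0 < w i -> a (xs i) != None.
Hypothesis gam01 : 0 < gam <= 1.
Hypothesis K_gt0 : (0 < K)%N.
Hypothesis K_large : 16 * m%:R <= gam ^+ 2 * K%:R.

(** From [2 ^ M * q ^ m <= (1 + q) ^ K] with [q = gam / 4], crude logarithms give
    [M / 2 <= m / q + q * K]. Each summand is at most [gam * K / 4], the first by [K_large]. *)
Lemma few_mistakes (M : nat) (z : 'I_K -> X) :
  (2 ^ M <= #|patterns H z|)%N -> M%:R <= gam * K%:R.
Proof.
have /andP [g0 g1] := gam01; pose q := gam / 4; have q0 : 0 < q by rewrite /q; lra.
have K0 : 0 < K%:R :> R by rewrite ltr0n.
move=> hM.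
have hP : #|patterns H z|%:R * q ^+ m <= (1 + q) ^+ K.
  by apply: card_patterns => //; rewrite /q; lra.
have h1 : expR (M%:R / 2) <= #|patterns H z|%:R :> R.
  apply: (@le_trans _ _ (2 ^+ M)); last by rewrite -natrX ler_nat.
  rewrite mulrC expRM_natr; apply: lerXn2r; rewrite ?nnegrE ?expR_ge0 //.
  have := expR_ge1Dx (- (2^-1 : R)); rewrite expRN => h.
  rewrite -[leRHS]invrK -[leLHS]invrK lef_pV2 ?posrE ?invr_gt0 ?expR_gt0 //.
  by apply: le_trans h; lra.
have h2 : expR (- (m%:R / q)) <= q ^+ m.
  rewrite mulrC -mulNr expRM_natr; apply: lerXn2r; rewrite ?nnegrE ?expR_ge0 ?(ltW q0) //.
  have := ln_sublinear (x := q^-1); rewrite invr_gt0 => /(_ q0).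
  rewrite lnV ?posrE // => h; rewrite -[leRHS]lnK ?posrE // ler_expR; lra.
have h3 : (1 + q) ^+ K <= expR (q * K%:R).
  by rewrite expRM_natr; apply: lerXn2r; rewrite ?nnegrE ?expR_ge0 ?expR_ge1Dx //; lra.
have : expR (M%:R / 2 - m%:R / q) <= expR (q * K%:R).
  rewrite expRD; apply: le_trans h3; apply: le_trans hP.
  by apply: ler_pM; rewrite ?expR_ge0.
rewrite ler_expR => h.
have h4 : m%:R / q <= gam * K%:R / 4.
  rewrite ler_pdivrMr // /q; move: K_large; rewrite expr2; lra.
have : q * K%:R = gam * K%:R / 4 by rewrite /q mulrAC.
by lra.
Qed.

(** For [K] points drawn from [w], the error of slot [t] on a fresh point has the same average as on
    its own point. Summed over the slots the latter counts mistakes, at most [gam * K], so some draw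
    and slot do no worse than average. *)
Lemma exists_halving :
  exists (e : {ffun 'I_K -> I}) (t : 'I_K),
    \sum_i w i * (halving_error H a (xs \o e) t (xs i))%:R <= gam * \sum_i w i.
Proof.
set S := \sum_i w i; have t0 := Ordinal K_gt0.
have [S0|Spos] := eqVneq S 0.
  exists [ffun => i0], t0; rewrite S0 mulr0 big1 // => i _.
  have /(_ i) -> : forall i, w i = 0.
    move=> j; apply/eqP; rewrite eq_le w_ge0 andbT -S0 /S (bigD1 j) //= lerDl.
    exact: sumr_ge0.
  by rewrite mul0r.
have Sgt : 0 < S by rewrite lt_neqAle eq_sym Spos sumr_ge0.
apply: contrapT => hn.
pose err (e : {ffun 'I_K -> I}) t := \sum_i w i * (halving_error H a (xs \o e) t (xs i))%:R.
have hlt e t : gam * S < err e t.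
  by rewrite ltNge; apply/negP => h; apply: hn; exists e, t.
have xs_setf (e : {ffun 'I_K -> I}) t i : xs \o setf e t i = upd (xs \o e) t (xs i).
  by apply/funext => j; rewrite /upd /= ffunE; case: eqP.
have h1 : \sum_(t < K) \sum_e prodw w e * err e t
    <= S * \sum_(e : {ffun 'I_K -> I}) prodw w e * (gam * K%:R).
  have -> : \sum_(t < K) \sum_e prodw w e * err e t
     = S * \sum_e prodw w e * (\sum_(t < K) halving_error H a (xs \o e) t (xs (e t)))%:R.
    under [in RHS]eq_bigr do rewrite natr_sum mulr_sumr.
    rewrite [in RHS]exchange_big /= mulr_sumr; apply: eq_bigr => t _.
    rewrite -(sum_resample w t (fun e => (halving_error H a (xs \o e) t (xs (e t)))%:R)).
    apply: eq_bigr => e _; congr (_ * _); apply: eq_bigr => i _.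
    by rewrite xs_setf setfE halving_error_upd.
  rewrite ler_pM2l //; apply: ler_sum => e _.
  (* The mistake bound needs [a] defined at all drawn points, which holds for draws of positive
     weight. *)
  have [e0|epos] := eqVneq (prodw w e) 0; first by rewrite e0 !mul0r.
  apply: ler_wpM2l; first exact: prodw_ge0.
  apply: (@few_mistakes _ (xs \o e)); apply: halving_errors => // j.
  apply/w_def/(prodw_gt0 w_ge0); rewrite lt_neqAle eq_sym epos; exact: prodw_ge0.
have h2 : \sum_(t < K) \sum_(e : {ffun 'I_K -> I}) prodw w e * (gam * S)
    < \sum_(t < K) \sum_e prodw w e * err e t.
  rewrite ltr_sum //; first by apply/hasP; exists t0; rewrite ?mem_index_enum.
  move=> t _; rewrite -subr_gt0 -sumrB.
  have : 0 < \sum_(e : {ffun 'I_K -> I}) prodw w e by rewrite sum_prodw exprn_gt0.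
  rewrite lt_neqAle sumr_ge0 ?andbT; last by move=> e _; exact: prodw_ge0.
  rewrite eq_sym psumr_neq0; last by move=> e _; exact: prodw_ge0.
  case/hasP => e _ /= e0; rewrite (bigD1 e) //= ltr_wpDr ?sumr_ge0 //.
    move=> e' _; rewrite -mulrBr mulr_ge0 ?prodw_ge0 // subr_ge0; exact: ltW.
  by rewrite -mulrBr mulr_gt0 // subr_gt0.
have := lt_le_trans h2 h1; rewrite sumr_const card_ord -!mulr_suml.
set P := \sum_e _.
have -> : S * (P * (gam * K%:R)) = P * (gam * S) *+ K by rewrite -(mulr_natr (P * _)); ring.
by rewrite ltxx.
Qed.

End WeakLearner.

(** * Counting grid thresholds below a value and in a window *)

Section Grid.
Variables (R : realType) (G : nat).

(* The thresholds are the midpoints of [G] equal subintervals of [[-1, 1]]. *)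
Definition grid (k : 'I_G) : R := -1 + (2 * k%:R + 1) / G%:R.

End Grid.

Lemma grid_rank (R : realType) (y : R) (G : nat) : 0 <= y <= 2 * G%:R ->
  `|\sum_(k < G) (if 2 * k%:R + 1 < y then 2 else 0) - y| <= 1.
Proof.
elim: G => [|G IH] /andP [y0]; rewrite -?[G.+1%:R]natr1 => yG.
  by rewrite big_ord0 ler_norml; lra.
rewrite big_ord_recr /=.
have [h|h] := leP y (2 * G%:R).
  have -> : (2 * G%:R + 1 < y) = false by apply/negbTE; rewrite -leNgt; lra.
  by rewrite addr0; apply: IH; rewrite y0 h.
rewrite (eq_bigr (fun=> 2)); last first.
  move=> k _; have -> // : (2 * k%:R + 1 < y).
  have : (k : nat)%:R + 1 <= G%:R :> R by rewrite natr1 ler_nat.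
  by lra.
rewrite sumr_const card_ord -[2 *+ G]mulr_natr; case: ltP => h'; rewrite ler_norml; lra.
Qed.

Lemma grid_window (R : realType) (y1 y2 : R) (G : nat) : y1 <= y2 ->
  2 * \sum_(k < G) (y1 <= 2 * k%:R + 1 <= y2)%R%:R <= y2 - y1 + 2.
Proof.
move=> y12; set c := fun G : nat => \sum_(k < G) (y1 <= 2 * k%:R + 1 <= y2)%R%:R : R.
(* The induction needs the bound in [G] too: odd integers counted so far lie between [y1] and
   [2 * G - 1]. *)
have : c G = 0 \/ 2 * c G <= 2 * G%:R + 1 - y1 /\ 2 * c G <= y2 + 2 - y1.
  elim: G => [|G IH]; first by left; rewrite /c big_ord0.
  have -> : c G.+1 = c G + (y1 <= 2 * G%:R + 1 <= y2)%R%:R by rewrite /c big_ord_recr.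
  rewrite -[G.+1%:R]natr1; case: (boolP (y1 <= 2 * G%:R + 1 <= y2)) => [/andP [h1 h2]|_] /=.
    by right; case: IH => [-> | [? ?]]; split; lra.
  by rewrite addr0; case: IH => [-> | [? ?]]; [left | right; split; lra].
by rewrite -/(c G); case=> [-> | []]; lra.
Qed.

(** * The agreement hypothesis and its gain, averaged over thresholds *)

Section Agreement.
Variables (R : realType) (X : Type).

Definition agree (s b : X -> option bool) : X -> option bool :=
  fun x => if s x == b x then s x else None.

Variables (eta1 eta2 : R).

Definition agreement (theta : R) (s b : X -> option R) : X -> option bool :=
  agree (binarize (fun _ => 0) eta1 s) (binarize (fun _ => theta) eta2 b).

Definition agreement_class (S B : set (X -> option R)) (theta : R) : set (X -> option bool) :=
  [set h | exists s b, [/\ S s, B b & h = agreement theta s b]].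

Lemma agreement_class_vc (S B : set (X -> option R)) (m : nat) (theta : R) (X' : seq X) :
  (supVC S B eta1 eta2 <= (m%:R)%:E)%E ->
  List.NoDup X' -> shatters (agreement_class S B theta) X' -> (size X' <= m)%N.
Proof.
move=> hm nd sh; rewrite -(ler_nat R) -lee_fin; apply: le_trans hm.
apply: le_trans (ereal_sup_ubound _ ); last by exists theta.
apply: ereal_sup_ubound; exists X' => //; split=> //; split=> xi.
- have [_ [s [b [Ss Bb ->]]] e] := sh xi.
  exists (binarize (fun _ => 0) eta1 s); first by exists s.
  by move=> x /e; rewrite /agreement /agree; case: ifP.
- have [_ [s [b [Ss Bb ->]]] e] := sh xi.
  exists (binarize (fun _ => theta) eta2 b); first by exists b.
  by move=> x /e; rewrite /agreement /agree; case: ifP => // /eqP ->.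
Qed.

Hypothesis eta1_gt0 : 0 < eta1.
Hypothesis eta2_gt0 : 0 < eta2.
Variables (s b : X -> option R) (x : X) (sv : R).
Hypothesis s_x : s x = Some sv.

Definition gain (a : option bool) : R := if a is Some _ then `|sv| else - `|sv|.

Lemma agreement_sign theta v : agreement theta s b x = Some v -> sv * sgnb R v = `|sv|.
Proof.
have e1 := eta1_gt0; rewrite /agreement /agree /binarize s_x; case: eqP => // _.
rewrite add0r sub0r; case: ltP => h; first by case=> <-; rewrite mulr1 gtr0_norm //; lra.
by case: ltP => // h' [<-]; rewrite mulrN1 ltr0_norm //; lra.
Qed.

(** A defined agreement label has the sign of [sv], so matching it earns the full gain. An error
    costs [2 * |sv|], at most [2]; at a star the gain is already the worst case. *)
Lemma gain_le theta (f : bool) (a := agreement theta s b x) :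
  `|sv| <= 1 -> gain a - 2 * ((a != None) && (a != Some f))%:R <= sv * sgnb R f.
Proof.
move=> sv1; have hs : - `|sv| <= sv * sgnb R f.
  have : `|sv * sgnb R f| <= `|sv|.
    by rewrite normrM; case: f; rewrite /= ?normrN normr1 mulr1.
  by rewrite ler_norml => /andP [].
case E: a => [v|] /=; last by rewrite mulr0 subr0.
case: (eqVneq v f) => [<-|ne]; first by rewrite eqxx /= mulr0 subr0 (agreement_sign E).
have -> : Some v != Some f by apply: contra ne => /eqP [->].
by rewrite /=; lra.
Qed.

(** Outside the [eta2]-window around [theta], [b] has the label of the comparison with [theta]. If
    [|sv| > eta1], agreement or disagreement with the sign of [sv] gives exactly the product on the
    left; otherwise the loss is at most [2 * eta1]. Inside the window the loss is at most [2]. *)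
Lemma gain_ge theta v : b x = Some v -> `|sv| <= 1 ->
  sv * (if theta < v then 1 else -1) - 2 * eta1 - 2 * (theta - eta2 <= v <= theta + eta2)%R%:R
    <= gain (agreement theta s b x).
Proof.
move=> b_x sv1; have e1 := eta1_gt0; have e2 := eta2_gt0.
have hs (t : R) : `|t| <= 1 -> sv * t <= `|sv|.
  by move=> t1; apply: (le_trans (ler_norm _)); rewrite normrM ler_piMr.
have hif : `|if theta < v then 1 else -1 : R| <= 1 by case: ifP; rewrite ?normrN normr1.
have := hs _ hif; have svn := normr_ge0 sv.
case: (boolP (theta - eta2 <= v <= theta + eta2)) => [_|].
  by move: (sv * _) => z /=; rewrite /gain; case: agreement => [_|]; lra.
rewrite negb_and -!ltNge mulr0 /agreement /agree /binarize s_x b_x add0r sub0r => hv hsv.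
have {hv} hv : v < theta - eta2 \/ theta + eta2 < v by case/orP: hv; [left | right].
rewrite /gain; have [sv0|sv0] := lerP 0 sv; rewrite ?(ger0_norm sv0) ?(ltr0_norm sv0);
  case: (ltP eta1 sv) => h1; try (case: (ltP sv (- eta1)) => h2);
  case: (ltP (theta + eta2) v) => h3; try (case: (ltP v (theta - eta2)) => h4);
  case: (ltP theta v) => h5; rewrite /=; lra.
Qed.

(** The sign of [v - theta] averages to [v] over [theta] in [[-1, 1]]. On the grid, rounding costs
    [1] and the window count [2] beyond its length, hence the [3]. A star of [b] loses [|sv|] at
    every threshold, as in [gprod]. *)
Lemma sum_gain (G : nat) : (0 < G)%N -> `|sv| <= 1 ->
  (forall v, b x = Some v -> -1 <= v <= 1) ->
  G%:R * (gprod sv (b x) - 2 * eta1 - 2 * eta2) - 3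
    <= \sum_(k < G) gain (agreement (grid R k) s b x).
Proof.
move=> G0 sv1 hb; have g0 : 0 < G%:R :> R by rewrite ltr0n.
have e1 := eta1_gt0; have e2 := eta2_gt0.
have p1 : 0 <= G%:R * eta1 by rewrite mulr_ge0 // ltW.
have p2 : 0 <= G%:R * eta2 by rewrite mulr_ge0 // ltW.
case E: (b x) => [v|] /=; last first.
  rewrite (eq_bigr (fun=> - `|sv|)); last first.
    by move=> k _; rewrite /agreement /agree /binarize E; case: eqP => // ->.
  by rewrite sumr_const card_ord -[_ *+ G]mulr_natl; lra.
apply: le_trans (ler_sum _ (fun k _ => gain_ge (grid R k) E sv1)).
(* In this scale the thresholds are the odd integers [1, 3, ..., 2 * G - 1]. *)
pose y := G%:R * (v + 1).
have gridE (k : 'I_G) (t : R) : (grid R k < v + t) = (2 * k%:R + 1 < y + G%:R * t).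
  rewrite /grid -[LHS](ltr_pM2l g0) mulrDr mulrCA divff ?gt_eqF // mulr1 /y.
  by apply/idP/idP; lra.
have gridE' (k : 'I_G) (t : R) : (v + t <= grid R k) = (y + G%:R * t <= 2 * k%:R + 1).
  by rewrite !leNgt gridE.
have gridE'' (k : 'I_G) (t : R) : (grid R k <= v + t) = (2 * k%:R + 1 <= y + G%:R * t).
  rewrite /grid -[LHS](ler_pM2l g0) mulrDr mulrCA divff ?gt_eqF // mulr1 /y.
  by apply/idP/idP; lra.
have hv := hb _ E.
have y02 : 0 <= y <= 2 * G%:R.
  by case/andP: hv => v1 v2; rewrite /y mulr_ge0 ?(ltW g0) /=; nra.
have := grid_rank y02; set F := \sum_(k < G) _ => hF.
have := @grid_window R (y - G%:R * eta2) (y + G%:R * eta2) G ltac:(lra).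
set c := \sum_(k < G) _ => hc.
rewrite !sumrB.
have -> : \sum_(k < G) sv * (if grid R k < v then 1 else -1) = sv * (F - G%:R).
  rewrite -mulr_sumr -[G in RHS]card_ord -[#|_|%:R]sumr_const -sumrB; congr (_ * _).
  apply: eq_bigr => k _; have := gridE k 0; rewrite addr0 mulr0 addr0 => ->.
  by case: ifP => _; ring.
have -> : \sum_(k < G) 2 * (grid R k - eta2 <= v <= grid R k + eta2)%R%:R = 2 * c.
  rewrite mulr_sumr; apply: eq_bigr => k _; congr (2 * (nat_of_bool _)%:R).
  have := gridE' k (- eta2); rewrite mulrN => <-; have := gridE'' k eta2 => <-.
  by rewrite andbC; congr andb; apply/idP/idP; lra.
rewrite sumr_const card_ord -[_ *+ G]mulr_natl.
have : `|sv * (F - y)| <= 1 by rewrite normrM; apply: mulr_ile1.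
rewrite ler_norml => /andP [h1 h2].
have : sv * (F - G%:R) = sv * (F - y) + G%:R * (sv * v) by rewrite /y; ring.
by lra.
Qed.

End Agreement.

(** * Discrete distributions and truncation to finitely many atoms *)

Lemma cvg_sum_seq (R : realType) (I : Type) (r : seq I) (f : I -> nat -> R) (l : I -> R) :
  (forall i, f i @ \oo --> l i) -> (fun n => \sum_(i <- r) f i n) @ \oo --> \sum_(i <- r) l i.
Proof.
move=> h; elim: r => [|i r IH].
  by rewrite big_nil; under eq_fun do rewrite big_nil; apply: cvg_cst.
by rewrite big_cons; under eq_fun do rewrite big_cons; apply: cvgD.
Qed.

Section DiscreteDistributions.
Variables (R : realType) (w : nat -> R).
Hypothesis w_dist : ddist w.

Let w_ge0 i : 0 <= w i. Proof. by case: w_dist. Qed.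

Let w_cvg : cvgn (series w). Proof. by case: w_dist => _ h; apply/cvg_ex; exists 1. Qed.

Lemma series_ndecr : nondecreasing_seq (series w).
Proof. by apply/nondecreasing_seqP => n; rewrite seriesSr lerDl. Qed.

Lemma ddist_series_le1 n : series w n <= 1.
Proof.
case: w_dist => _ /cvg_lim <- //; apply: nondecreasing_cvgn_le => //.
exact: series_ndecr.
Qed.

Lemma series_tail (f : nat -> R) (c : R) (M n : nat) :
  (forall i, `|f i| <= c * w i) -> (M <= n)%N ->
  `|series f n - series f M| <= c * (series w n - series w M).
Proof.
move=> fw Mn; rewrite !sub_series_geq // mulr_sumr.
by apply: (le_trans (ler_norm_sum _ _ _)); apply: ler_sum.
Qed.

Lemma series_dominated_cvg (f : nat -> R) (c : R) :
  (forall i, `|f i| <= c * w i) -> cvgn (series f).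
Proof.
move=> fw; apply: normed_cvg; apply: (@series_le_cvg _ _ (fun i => c * w i)) => //=.
- by move=> i; apply: (le_trans (normr_ge0 _) (fw i)).
- by apply: (@is_cvg_seriesZ _ w c); apply: w_cvg.
Qed.

Lemma lim_series_tail (f : nat -> R) (c : R) (M : nat) : 0 <= c ->
  (forall i, `|f i| <= c * w i) ->
  `|limn (series f) - series f M| <= c * (1 - series w M).
Proof.
move=> c0 fw; have cf := series_dominated_cvg fw.
have cn : `|series f n - series f M| @[n --> \oo] --> `|limn (series f) - series f M|.
  by apply: cvg_norm; apply: cvgB => //; apply: cvg_cst.
rewrite -(cvg_lim _ cn) //; apply: limr_le; first by apply/cvg_ex; eexists; exact: cn.
near=> n; apply: (le_trans (series_tail fw _)); first by near: n; exact: nbhs_infty_ge.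
by apply: ler_wpM2l => //; rewrite lerD2r ddist_series_le1.
Unshelve. all: by end_near. Qed.

Lemma ddist_truncation (e : R) : 0 < e -> exists M, 1 - e <= series w M.
Proof.
move=> e0; case: w_dist => _ /cvgrPdist_le /(_ e e0) [M _ /(_ M (leqnn M))] h.
by exists M; move: h => /=; rewrite ler_norml; lra.
Qed.

End DiscreteDistributions.

(** * Replacing [y] by its conditional mean on a truncated distribution *)

Section Grouping.
Variables (R : realType) (X : Type) (S : set (X -> option R)).
Variables (w : nat -> R) (p : nat -> X * R) (s : X -> option R).
Hypothesis w_dist : ddist w.
Hypothesis y_le1 : forall i, `|(p i).2| <= 1.
Hypothesis s_le1 : forall x, `|odflt 0 (s x)| <= 1.
Hypothesis s_mean : forall i, 0 < w i -> exists v, s (p i).1 = Some v /\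
  expect w p (fun z => \1_[set (p i).1] z.1 * z.2)
    = v * expect w p (fun z => \1_[set (p i).1] z.1).

Let w_ge0 i : 0 <= w i. Proof. by case: w_dist. Qed.
Let sv (x : X) : R := odflt 0 (s x).
Let chi (x x' : X) : R := \1_[set x] x'.

Let chi_eq x x' : x' = x -> chi x x' = 1.
Proof. by move=> ->; rewrite /chi indicE mem_set. Qed.

Let chi_neq x x' : x' <> x -> chi x x' = 0.
Proof. by move=> ne; rewrite /chi indicE memNset. Qed.

Let chi_ge0 x x' : 0 <= chi x x'.
Proof. by rewrite /chi indicE. Qed.

Let chi_le1 x x' : `|chi x x'| <= 1.
Proof. by rewrite /chi indicE; case: (_ \in _); rewrite ?normr1 ?normr0. Qed.

(** The conditional-mean hypothesis in additive form: the residuals [y - s(x)] of all atoms over one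
    point cancel. *)
Lemma class_residual (i : nat) : 0 < w i ->
  (fun n => series (fun k => w k * (chi (p i).1 (p k).1 * ((p k).2 - sv (p i).1))) n) @ \oo --> (0 : R).
Proof.
move=> wi; have [v [sx e]] := s_mean wi.
have c1 : cvgn (series (fun k => w k * (chi (p i).1 (p k).1 * (p k).2))).
  apply: (series_dominated_cvg w_dist (c := 1)) => k.
  rewrite mul1r normrM ger0_norm // ler_piMr // normrM mulr_ile1 //.
have c2 : cvgn (series (fun k => w k * chi (p i).1 (p k).1)).
  apply: (series_dominated_cvg w_dist (c := 1)) => k.
  by rewrite mul1r normrM ger0_norm // ler_piMr.
have -> : (fun n => series (fun k => w k * (chi (p i).1 (p k).1 * ((p k).2 - sv (p i).1))) n)
  = (fun n => series (fun k => w k * (chi (p i).1 (p k).1 * (p k).2)) n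
      - v * series (fun k => w k * chi (p i).1 (p k).1) n).
  apply/funext => n; rewrite /series /= mulr_sumr -sumrB; apply: eq_bigr => k _.
  by rewrite /sv sx /=; ring.
have -> : 0 = limn (series (fun k => w k * (chi (p i).1 (p k).1 * (p k).2)))
     - v * limn (series (fun k => w k * chi (p i).1 (p k).1)).
  by move: e; rewrite /expect => ->; rewrite subrr.
by apply: cvgB => //; apply: cvgMr.
Qed.

(* Each atom below [M] is weighted by its conditional probability, among the first [M] atoms,
   given its point; this replaces a choice of representatives of the points. *)
Lemma grouping (g : X -> R) (M : nat) : (forall x, `|g x| <= 1) ->
  `|\sum_(k < M) w k * (((p k).2 - sv (p k).1) * g (p k).1)| <= 2 * (1 - series w M).
Proof.
move=> g1.
pose Q (x : X) := \sum_(j < M) w j * chi x (p j).1.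
pose alpha (i : 'I_M) := w i / Q (p i).1 * g (p i).1.
pose c (x : X) := \sum_(i < M) w i / Q (p i).1 * chi (p i).1 x.
(* [c] is [1] at points of positive weight among the first [M] atoms and [0] elsewhere, since
   [0 / 0 = 0]. So [F] agrees with the summand below [M], while its full series is a finite
   combination of class residuals and vanishes; only the tail beyond [M] remains. *)
pose F k := w k * (((p k).2 - sv (p k).1) * g (p k).1 * c (p k).1).
have Q0 x : 0 <= Q x by apply: sumr_ge0 => j _; rewrite mulr_ge0.
have cE x : c x = Q x / Q x.
  rewrite /c {2}/Q mulr_suml; apply: eq_bigr => i _.
  have [e|ne] := pselect (x = (p i).1); first by rewrite e !chi_eq // !mulr1.
  by rewrite !chi_neq ?mulr0 ?mul0r //; exact: nesym.
have c01 x : 0 <= c x <= 1.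
  rewrite cE; have [->|ne] := eqVneq (Q x) 0; first by rewrite mul0r lexx ler01.
  by rewrite divff // ler01 lexx.
have FE k : F k = \sum_(i < M) alpha i * (w k * (chi (p i).1 (p k).1 * ((p k).2 - sv (p i).1))).
  rewrite /F /c !mulr_sumr; apply: eq_bigr => i _; rewrite /alpha.
  have [e|ne] := pselect ((p k).1 = (p i).1); first by rewrite e !chi_eq //; ring.
  by rewrite chi_neq //; ring.
have limF : series F @ \oo --> (0 : R).
  have -> : series F = (fun n => \sum_(i < M) alpha i *
      series (fun k => w k * (chi (p i).1 (p k).1 * ((p k).2 - sv (p i).1))) n).
    apply/funext => n; rewrite /series /=; under eq_bigr do rewrite FE.
    by rewrite exchange_big /=; apply: eq_bigr => i _; rewrite mulr_sumr.
  have z : \sum_(i < M) (0 : R) = 0 by rewrite big1.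
  rewrite -[X in _ --> X]z.
  apply: (@cvg_sum_seq R 'I_M (index_enum 'I_M) (fun i n => alpha i *
      series (fun k => w k * (chi (p i).1 (p k).1 * ((p k).2 - sv (p i).1))) n) (fun=> 0)) => i.
  have [wi|wi] := ltP 0 (w i).
    by rewrite -(mulr0 (alpha i)); apply: cvgMr; apply: class_residual.
  have -> : alpha i = 0.
    by rewrite /alpha (_ : w i = 0) ?mul0r //; apply/eqP; rewrite eq_le wi w_ge0.
  by under eq_fun do rewrite mul0r; apply: cvg_cst.
have Fw k : `|F k| <= 2 * w k.
  have := c01 (p k).1; rewrite /F; set ck := c _ => /andP [c0 c1].
  rewrite normrM ger0_norm // mulrC ler_wpM2r // 2!normrM (ger0_norm c0) -mulrA.
  have h : `|(p k).2 - sv (p k).1| <= 2.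
    by apply: (le_trans (ler_normB _ _)); have := y_le1 k; have := s_le1 (p k).1; rewrite -/(sv _); lra.
  rewrite -[leRHS]mulr1; apply: ler_pM => //; first by rewrite mulr_ge0.
  by rewrite mulr_ile1.
have -> : \sum_(k < M) w k * (((p k).2 - sv (p k).1) * g (p k).1) = series F M.
  rewrite /series /= big_mkord; apply: eq_bigr => k _; rewrite /F.
  have [wk|wk] := eqVneq (w k) 0; first by rewrite wk !mul0r.
  rewrite cE divff ?mulr1 // gt_eqF // /Q (bigD1 k) //= chi_eq // mulr1.
  rewrite ltr_pwDl ?sumr_ge0 //; first by rewrite lt_neqAle eq_sym wk w_ge0.
  by move=> j _; rewrite mulr_ge0.
have := @lim_series_tail _ _ w_dist F 2 M ltac:(by []) Fw.
by rewrite (cvg_lim _ limF) // sub0r normrN.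
Qed.

Lemma expect_truncate (g : X * R -> R) (M : nat) : (forall i, `|g (p i)| <= 1) ->
  `|expect w p g - \sum_(i < M) w i * g (p i)| <= 1 - series w M.
Proof.
move=> g1; have := @lim_series_tail _ _ w_dist (fun i => w i * g (p i)) 1 M ler01.
rewrite mul1r {2}/series /= big_mkord; apply => i.
by rewrite mul1r normrM ger0_norm // ler_piMr.
Qed.

End Grouping.

(** * The candidates and the learner maximizing empirical correlation *)

Section Learner.
Variables (R : realType) (X : Type) (S B : set (X -> option R)) (eta1 eta2 : R).
Variables (G K N : nat).
Hypothesis G_gt0 : (0 < G)%N.
Hypothesis K_gt0 : (0 < K)%N.
Hypothesis N_gt0 : (0 < N)%N.

(* Threshold, slot of the query, positions of the [K] points in the sample, and their labels. *)
Definition candidate : finType := ('I_G * 'I_K * {ffun 'I_K -> 'I_N} * {set 'I_K})%type.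

(** Only the points of the sample are read; the agreement labels are not observed, so [lab] guesses
    them. *)
Definition output (z : 'I_N -> X * R) (c : candidate) : X -> bool :=
  let: (k, t, e, lab) := c in
  halving_predictor (agreement_class eta1 eta2 S B (grid R k)) (fun j => (z (e j)).1) lab t.

Definition empirical_corr (z : 'I_N -> X * R) (c : candidate) : R :=
  \sum_i (z i).2 * sgnb R (output z c (z i).1).

Definition candidate0 : candidate :=
  (Ordinal G_gt0, Ordinal K_gt0, [ffun => Ordinal N_gt0], finset.set0).

Definition best (z : 'I_N -> X * R) : candidate :=
  [arg max_(c > candidate0) empirical_corr z c]%O.

Lemma bestP z c : empirical_corr z c <= empirical_corr z (best z).
Proof. by rewrite /best; case: Order.TotalTheory.arg_maxP => // c' _ /(_ c); apply. Qed.

Definition learn (z : 'I_N -> X * R) : X -> bool := output z (best z).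

(** The sample positions on which the output depends, left out in the Chernoff bound. *)
Definition support (c : candidate) : {set 'I_N} := [set c.1.2 j | j in 'I_K]%SET.

Lemma card_support c : (#|support c| <= K)%N.
Proof. by rewrite -[X in (_ <= X)%N]card_ord; apply: leq_imset_card. Qed.

Lemma output_eq z z' c : (forall j, j \in support c -> z j = z' j) -> output z c = output z' c.
Proof.
case: c => [[[k t] e] lab] h; rewrite /output; congr halving_predictor.
by apply/funext => j; rewrite h //; apply: finset.imset_f.
Qed.

Lemma card_candidate : (#|candidate| = G * K * N ^ K * 2 ^ K)%N.
Proof.
rewrite !card_prod card_ffun !card_ord -(finset.cardsT {set 'I_K}).
by rewrite -finset.powersetT finset.card_powerset finset.cardsT card_ord.
Qed.

End Learner.

Lemma sgnb_norm (R : realType) f : `|sgnb R f| = 1.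
Proof. by case: f; rewrite /= ?normrN normr1. Qed.

(** * Error analysis of the learner on the first [M] atoms *)

Section Analysis.
Variables (R : realType) (X : Type) (S B : set (X -> option R)) (eta1 eta2 gam : R).
Variables (G K N M m : nat).
Hypothesis G_gt0 : (0 < G)%N.
Hypothesis K_gt0 : (0 < K)%N.
Hypothesis N_gt0 : (0 < N)%N.
Variables (w : nat -> R) (p : nat -> X * R) (s b : X -> option R).
Hypothesis w_dist : ddist w.
Hypothesis y_le1 : forall i, `|(p i).2| <= 1.
Hypothesis s_mean : forall i, 0 < w i -> exists v, s (p i).1 = Some v /\
  expect w p (fun z => \1_[set (p i).1] z.1 * z.2)
    = v * expect w p (fun z => \1_[set (p i).1] z.1).
Hypothesis S_le1 : real_valued_class S.
Hypothesis B_le1 : real_valued_class B.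
Hypothesis Ss : S s.
Hypothesis Bb : B b.
Hypothesis vc : (supVC S B eta1 eta2 <= (m%:R)%:E)%E.
Hypothesis gam01 : 0 < gam <= 1.
Hypothesis K_large : 16 * m%:R <= gam ^+ 2 * K%:R.
Hypothesis eta1_gt0 : 0 < eta1.
Hypothesis eta2_gt0 : 0 < eta2.

Let sv (x : X) : R := odflt 0 (s x).
Let tau : R := 1 - series w M.

Let sv_le1 x : `|sv x| <= 1.
Proof.
rewrite /sv; case E: (s x) => [v|] /=; last by rewrite normr0.
by rewrite ler_norml; apply: S_le1 Ss _ _ E.
Qed.

Let w_ge0 i : 0 <= w i. Proof. by case: w_dist. Qed.

Let wS : series w M = \sum_(i < M) w i.
Proof. by rewrite /series /= big_mkord. Qed.

Let S1 : series w M <= 1. Proof. exact: ddist_series_le1. Qed.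

Let s_def i : w i != 0 -> s (p i).1 = Some (sv (p i).1).
Proof.
move=> wi; have [|v [e _]] := s_mean (i := i); first by rewrite lt_neqAle eq_sym wi w_ge0.
by rewrite /sv e.
Qed.

Lemma corr_swap (g : X -> R) : (forall x, `|g x| <= 1) ->
  `|\sum_(i < M) w i * ((p i).2 * g (p i).1) - \sum_(i < M) w i * (sv (p i).1 * g (p i).1)|
     <= 2 * tau.
Proof.
move=> g1; have := grouping w_dist y_le1 sv_le1 s_mean M g1.
rewrite -sumrB; congr (`|_| <= _).
by apply: eq_bigr => i _; rewrite -/(sv _); ring.
Qed.

(** [gprod] is not linear at a star, so a star is replaced by minus the sign of [sv]. The resulting
    [h] reproduces [gprod] against [sv] and can only exceed it against [y], and [corr_swap] applies
    to [h]. *)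
Lemma corr_gprod :
  \sum_(i < M) w i * gprod (p i).2 (b (p i).1) - 2 * tau
    <= \sum_(i < M) w i * gprod (sv (p i).1) (b (p i).1).
Proof.
pose h x := if b x is Some v then v else - (if 0 <= sv x then 1 else -1).
have h1 x : `|h x| <= 1.
  rewrite /h; case E: (b x) => [v|]; first by rewrite ler_norml; apply: B_le1 Bb _ _ E.
  by rewrite normrN; case: ifP; rewrite ?normrN normr1.
have := corr_swap h1; rewrite ler_norml => /andP [_].
have -> : \sum_(i < M) w i * gprod (sv (p i).1) (b (p i).1)
   = \sum_(i < M) w i * (sv (p i).1 * h (p i).1).
  apply: eq_bigr => i _; rewrite /h; case: (b _) => [v //|] /=; congr (_ * _).
  case: lerP => h0; first by rewrite mulrN mulr1 ger0_norm.
  by rewrite ltr0_norm // !opprK mulr1.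
have : \sum_(i < M) w i * gprod (p i).2 (b (p i).1) <= \sum_(i < M) w i * ((p i).2 * h (p i).1).
  apply: ler_sum => i _; apply: ler_wpM2l => //; have := h1 (p i).1.
  rewrite /h; case: (b _) => [v //|] /= hx.
  rewrite lerNl -mulrN; apply: le_trans (ler_norm _) _.
  by rewrite normrM normrN ler_piMr.
lra.
Qed.

Let agr (k : 'I_G) := agreement eta1 eta2 (grid R k) s b.

Lemma exists_threshold : exists k : 'I_G,
  \sum_(i < M) w i * gprod (sv (p i).1) (b (p i).1) - 2 * eta1 - 2 * eta2 - 3 / G%:R
    <= \sum_(i < M) w i * gain (sv (p i).1) (agr k (p i).1).
Proof.
have g0 : 0 < G%:R :> R by rewrite ltr0n.
have e1 := eta1_gt0; have e2 := eta2_gt0.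
pose Z := \sum_(i < M) w i * gprod (sv (p i).1) (b (p i).1).
pose L := \sum_(i < M) w i * (gprod (sv (p i).1) (b (p i).1) - 2 * eta1 - 2 * eta2 - 3 / G%:R).
have LE : Z - 2 * eta1 - 2 * eta2 - 3 / G%:R <= L.
  have -> : L = Z - series w M * (2 * eta1 + 2 * eta2 + 3 / G%:R).
    by rewrite /L /Z wS mulr_suml -sumrB; apply: eq_bigr => i _; ring.
  have h0 : 0 <= 2 * eta1 + 2 * eta2 + 3 / G%:R by rewrite !addr_ge0 ?mulr_ge0 ?invr_ge0 // ltW.
  by have := ler_piMl h0 S1; lra.
have avg : G%:R * L <= \sum_(k < G) \sum_(i < M) w i * gain (sv (p i).1) (agr k (p i).1).
  rewrite exchange_big /L mulr_sumr; apply: ler_sum => i _ /=; rewrite -mulr_sumr mulrCA.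
  have [->|wi] := eqVneq (w i) 0; first by rewrite !mul0r.
  apply: ler_wpM2l => //.
  have := sum_gain (b := b) eta1_gt0 eta2_gt0 (s_def wi) G_gt0 (sv_le1 _) (B_le1 Bb (x := _)).
  by rewrite !mulrBr [G%:R * (3 / _)]mulrC divfK ?gt_eqF //; apply: le_trans; lra.
apply: contrapT => hn.
have hlt (k : 'I_G) : \sum_(i < M) w i * gain (sv (p i).1) (agr k (p i).1) < L.
  rewrite ltNge; apply/negP => h; apply: hn; exists k; exact: le_trans h.
suff : \sum_(k < G) \sum_(i < M) w i * gain (sv (p i).1) (agr k (p i).1) < G%:R * L by lra.
have -> : G%:R * L = \sum_(k < G) L by rewrite sumr_const card_ord mulr_natl.
by apply: ltr_sum => //; apply/hasP; exists (Ordinal G_gt0); rewrite ?mem_index_enum.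
Qed.

Variable k0 : 'I_G.
Let a := agr k0.
Let err (f : X -> bool) (x : X) : R := ((a x != None) && (a x != Some (f x)))%:R.

Notation output := (output S B eta1 eta2 (G := G) (K := K) (N := N)).

(** The weak learner runs on the sample points where [a] is defined, each with weight one; elsewhere
    [err] is zero. *)
Lemma exists_candidate (z : 'I_N -> X * R) :
  exists c : candidate G K N, \sum_(i < N) err (output z c) (z i).1 <= gam * N%:R.
Proof.
pose xs i := (z i).1; pose u i : R := (a (xs i) != None)%:R.
have u0 i : 0 <= u i by [].
have ud i : 0 < u i -> a (xs i) != None by rewrite /u; case: (_ != _); rewrite ?ltxx.
have Ha : agreement_class eta1 eta2 S B (grid R k0) a by exists s, b.
have [e [t he]] := exists_halving (Ordinal N_gt0)
   (fun X' => @agreement_class_vc R X eta1 eta2 S B m (grid R k0) X' vc) u0 Ha ud gam01 K_gt0 K_large.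
exists (k0, t, e, label_set a (xs \o e)).
have g0 : 0 <= gam by case/andP: gam01 => /ltW.
apply: (@le_trans _ _ (gam * \sum_i u i)); last first.
  apply: ler_wpM2l => //; rewrite -[X in _ <= X%:R]card_ord -[leRHS]sumr_const.
  by apply: ler_sum => i _; rewrite /u; case: (_ != _).
apply: le_trans he; apply: ler_sum => i _; rewrite /err /u /halving_error /output -/(xs i).
by case: (a (xs i) != None); rewrite /= ?mul1r ?mul0r.
Qed.

Definition sample (u : {ffun 'I_N -> 'I_M}) : 'I_N -> X * R := fun j => p (u j).

(** Three one-sided tests: the empirical correlation from above, from below, and the true error from
    above by the empirical one. *)
Definition deviation (c : candidate G K N) (q : option bool) (u : {ffun 'I_N -> 'I_M}) (i : 'I_M) : R :=
  match q with
  | Some true => (p i).2 * sgnb R (output (sample u) c (p i).1)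
  | Some false => - ((p i).2 * sgnb R (output (sample u) c (p i).1))
  | None => - err (output (sample u) c) (p i).1
  end.

Lemma deviation_le1 c q u i : `|deviation c q u i| <= 1.
Proof.
rewrite /deviation /err; case: q => [[]|]; rewrite ?normrN ?normrM ?sgnb_norm ?mulr1 //.
by case: (_ && _); rewrite ?normr1 ?normr0.
Qed.

Lemma deviation_setf c q u j i i' :
  j \notin support c -> deviation c q (setf u j i) i' = deviation c q u i'.
Proof.
move=> jc; rewrite /deviation (_ : output (sample (setf u j i)) c = output (sample u) c) //.
apply: output_eq => k kc; rewrite /sample setf_neq //.
by apply: contra jc => /eqP <-.
Qed.

Definition deviates c q (u : {ffun 'I_N -> 'I_M}) : bool :=
  N%:R * (mean (fun i : 'I_M => w i) (deviation c q) u + gam) < \sum_j deviation c q u (u j).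

(** With [lam = gam / 18], the bound on [tau] is the mass condition [lam / 2] of the Chernoff
    bound. *)
Lemma deviates_prob c q : tau <= gam / 36 ->
  \sum_u prodw (fun i : 'I_M => w i) u * (deviates c q u)%:R
    <= expR (K%:R - gam ^+ 2 * N%:R / 36).
Proof.
move=> ht; have /andP [g0 g1] := gam01; rewrite /deviates.
have -> : N%:R = #|'I_N|%:R :> R by rewrite card_ord.
apply: (concentration (lam := gam / 18) (D := support c)) => //.
- by rewrite -wS.
- by rewrite divr_gt0.
- by lra.
- by rewrite -wS; move: ht; rewrite /tau; lra.
- exact: deviation_le1.
- by move=> *; exact: deviation_setf.
- exact: ltW.
- exact: card_support.
Qed.

Hypothesis k0_good :
  \sum_(i < M) w i * gprod (sv (p i).1) (b (p i).1) - 2 * eta1 - 2 * eta2 - 3 / G%:R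
    <= \sum_(i < M) w i * gain (sv (p i).1) (a (p i).1).

Let corr (f : X -> bool) : R := \sum_(i < M) w i * ((p i).2 * sgnb R (f (p i).1)).

Lemma corr_candidate f : \sum_(i < M) w i * err f (p i).1 <= 2 * gam ->
  \sum_(i < M) w i * gprod (sv (p i).1) (b (p i).1) - 2 * eta1 - 2 * eta2 - 3 / G%:R
     - 4 * gam - 2 * tau <= corr f.
Proof.
move=> he; have := @corr_swap (fun x => sgnb R (f x)) ltac:(by move=> x; rewrite sgnb_norm).
rewrite ler_norml => /andP [+ _]; rewrite -/(corr f) => h1.
have h2 : \sum_(i < M) w i * gain (sv (p i).1) (a (p i).1) - 2 * \sum_(i < M) w i * err f (p i).1
   <= \sum_(i < M) w i * (sv (p i).1 * sgnb R (f (p i).1)).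
  rewrite mulr_sumr -sumrB; apply: ler_sum => i _.
  have [->|wi] := eqVneq (w i) 0; first by rewrite !mul0r mulr0 subr0.
  rewrite mulrCA -mulrBr; apply: ler_wpM2l => //.
  exact: gain_le (s_def wi) _ _ (sv_le1 _).
have := k0_good; lra.
Qed.

(** The [6 * gam] is [4] from the candidate's error of at most [2 * gam], and [2] from comparing
    empirical with true correlation twice. The [6 * tau] is [2] for each passage between [y] and
    [sv], and [1] for each truncated expectation. *)
Lemma learn_good (u : {ffun 'I_N -> 'I_M}) :
  (forall c q, ~~ deviates c q u) ->
  expect w p (fun z => gprod z.2 (b z.1))
     - (2 * eta1 + 2 * eta2 + 3 / G%:R + 6 * gam + 6 * tau)
  <= expect w p (fun z => z.2 * sgnb R (learn S B eta1 eta2 G_gt0 K_gt0 N_gt0 (sample u) z.1)).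
Proof.
move=> hu; set z := sample u; have n0 : 0 < N%:R :> R by rewrite ltr0n.
have hdev c q : \sum_j deviation c q u (u j)
    <= N%:R * (mean (fun i : 'I_M => w i) (deviation c q) u + gam).
  by rewrite leNgt; apply: hu.
have upper c : empirical_corr S B eta1 eta2 z c <= N%:R * (corr (output z c) + gam).
  exact: (hdev c (Some true)).
have lower c : N%:R * (corr (output z c) - gam) <= empirical_corr S B eta1 eta2 z c.
  have := hdev c (Some false); rewrite /mean /deviation sumrN.
  under [X in _ <= _ * (X + _)]eq_bigr do rewrite mulrN.
  by rewrite sumrN -/(corr (output z c)) -/(empirical_corr S B eta1 eta2 z c); lra.
have [c hc] := exists_candidate z.
have herr : \sum_(i < M) w i * err (output z c) (p i).1 <= 2 * gam.
  have := hdev c None; rewrite /mean /deviation sumrN.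
  under [X in _ <= _ * (X + _)]eq_bigr do rewrite mulrN.
  rewrite sumrN => h.
  have : N%:R * \sum_(i < M) w i * err (output z c) (p i).1 <= N%:R * (2 * gam).
    by move: hc h; rewrite /z /sample; lra.
  by rewrite ler_pM2l.
have h1 := corr_candidate herr.
have h2 : corr (output z c) - 2 * gam <= corr (learn S B eta1 eta2 G_gt0 K_gt0 N_gt0 z).
  rewrite -(ler_pM2l n0).
  have := upper (best S B eta1 eta2 G_gt0 K_gt0 N_gt0 z).
  have := bestP S B eta1 eta2 G_gt0 K_gt0 N_gt0 z c; have := lower c.
  by rewrite /learn; lra.
have h3 := corr_gprod.
have y1 i : `|(p i).2 * sgnb R (learn S B eta1 eta2 G_gt0 K_gt0 N_gt0 z (p i).1)| <= 1.
  by rewrite normrM sgnb_norm mulr1.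
have := expect_truncate w_dist (g := fun z' =>
  z'.2 * sgnb R (learn S B eta1 eta2 G_gt0 K_gt0 N_gt0 z z'.1)) M y1.
have g1 i : `|gprod (p i).2 (b (p i).1)| <= 1.
  rewrite /gprod; case E: (b _) => [v|]; last by rewrite normrN normr_id.
  by rewrite normrM mulr_ile1 // ler_norml; apply: B_le1 Bb _ _ E.
have := expect_truncate w_dist (g := fun z' => gprod z'.2 (b z'.1)) M g1.
rewrite -/tau -/(corr _) !ler_norml => /andP [_ ?] /andP [? _].
by lra.
Qed.

Lemma learn_fail_prob (good : {ffun 'I_N -> 'I_M} -> bool) :
  tau <= gam / 36 ->
  (forall u, (forall c q, ~~ deviates c q u) -> good u) ->
  \sum_u prodw (fun i : 'I_M => w i) u * (~~ good u)%:R
    <= (3 * G * K * N ^ K * 2 ^ K)%:R * expR (K%:R - gam ^+ 2 * N%:R / 36).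
Proof.
move=> ht hgood.
(* Union bound over the candidates and the three tests. *)
apply: (@le_trans _ _ (\sum_(cq : candidate G K N * option bool)
   \sum_u prodw (fun i : 'I_M => w i) u * (deviates cq.1 cq.2 u)%:R)).
  rewrite exchange_big; apply: ler_sum => u _ /=; rewrite -mulr_sumr.
  apply: ler_wpM2l; first exact: prodw_ge0.
  case: (boolP (good u)) => [_|/negP ng] /=; first exact: sumr_ge0.
  have [cq hcq] : exists cq : candidate G K N * option bool, deviates cq.1 cq.2 u.
    apply: contrapT => hn; apply: ng; apply: hgood => c q.
    by apply/negP => h; apply: hn; exists (c, q).
  by rewrite (bigD1 cq) //= hcq lerDl sumr_ge0.
apply: le_trans (ler_sum _ (fun cq _ => deviates_prob cq.1 cq.2 ht)) _.
rewrite sumr_const card_prod card_candidate card_option card_bool.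
have -> : (G * K * N ^ K * 2 ^ K * 3 = 3 * G * K * N ^ K * 2 ^ K)%N by rewrite mulnC !mulnA.
by rewrite mulr_natl.
Qed.

End Analysis.

(** * From finite product weights to the success probability *)

Lemma bernoulli (R : realDomainType) (t : R) (n : nat) : 0 <= t <= 1 -> 1 - n%:R * t <= (1 - t) ^+ n.
Proof.
move=> /andP [t0 t1]; elim: n => [|n IH]; first by rewrite mul0r subr0.
rewrite exprS -[n.+1%:R]natr1; have n0 : 0 <= n%:R :> R by [].
have : (1 - t) * (1 - n%:R * t) <= (1 - t) * (1 - t) ^+ n by apply: ler_wpM2l => //; lra.
have : 0 <= n%:R * t * t by rewrite !mulr_ge0.
by lra.
Qed.

Lemma ddist_dirac (R : realType) : ddist (fun k : nat => (k == 0%N)%:R : R).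
Proof.
split=> [i|]; first by [].
apply: (@cvg_near_cst _ _ (1 : R)).
near=> n; have n0 : (0 < n)%N by near: n; exact: nbhs_infty_gt.
rewrite /series /= big_mkord (bigD1 (Ordinal n0)) //= big1 ?addr0 //.
by move=> i; rewrite -val_eqE /= => /negbTE ->.
Unshelve. all: by end_near. Qed.

(** The terms with seed [0] and all atoms below [M] form a finite partial sum of a nonnegative
    sum. *)
Lemma success_prob_ge (R : realType) (X : Type) (N M : nat) (w : nat -> R) (p : nat -> X * R)
    (rho : nat -> R) (A : nat -> seq (X * R) -> X -> bool) (good : (X -> bool) -> bool) :
  (forall i, 0 <= w i) -> rho 0%N = 1 ->
  ((\sum_(u : {ffun 'I_N -> 'I_M}) prodw (fun i : 'I_M => w i) u
     * (good (A 0%N [seq p (u i) | i <- enum 'I_N]))%:R)%:E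
   <= success_prob N w p rho A good)%E.
Proof.
move=> w0 rho0; rewrite /success_prob.
pose iota (u : {ffun 'I_N -> 'I_M}) : N.-tuple nat * nat := ([tuple (u i : nat) | i < N], 0%N).
have iota_inj : injective iota.
  move=> u v /(congr1 (fun x => val x.1)) /= e; apply/ffunP => i; apply: val_inj => /=.
  by move/eq_in_map: e => /(_ i); apply; rewrite mem_enum.
apply: esum_ge; exists [set` [seq iota u | u <- enum {ffun 'I_N -> 'I_M}]].
  by split => //; exact: finite_seq.
rewrite -fsbig_seq ?(map_inj_uniq iota_inj) ?enum_uniq //.
rewrite big_map big_enum /= sumEFin lee_fin; apply: ler_sum => u _.
rewrite rho0 mulr1 big_map -map_comp -[tval (ord_tuple N)]/(enum 'I_N) big_enum.
by [].
Qed.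

(** * Existence of the learner under numerical conditions on its parameters *)

Section Existence.
Variables (R : realType) (X : Type) (S B : set (X -> option R)) (eta1 eta2 gam eps delta : R).
Variables (G K N m : nat).
Hypothesis G_gt0 : (0 < G)%N.
Hypothesis K_gt0 : (0 < K)%N.
Hypothesis N_gt0 : (0 < N)%N.
Hypothesis S_le1 : real_valued_class S.
Hypothesis B_le1 : real_valued_class B.
Hypothesis vc : (supVC S B eta1 eta2 <= (m%:R)%:E)%E.
Hypothesis gam01 : 0 < gam <= 1.
Hypothesis K_large : 16 * m%:R <= gam ^+ 2 * K%:R.
Hypothesis eta1_gt0 : 0 < eta1.
Hypothesis eta2_gt0 : 0 < eta2.
Hypothesis delta_gt0 : 0 < delta.
Hypothesis fail_small :
  (3 * G * K * N ^ K * 2 ^ K)%:R * expR (K%:R - gam ^+ 2 * N%:R / 36) <= delta / 2.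
Hypothesis eps_large : 2 * eta1 + 2 * eta2 + 3 / G%:R + 8 * gam <= eps.

(** Recovers the indexed sample from the list by choice; a list of another length gets an arbitrary
    output. *)
Definition learner (_ : nat) (sq : seq (X * R)) : X -> bool :=
  match pselect (exists z : 'I_N -> X * R, sq = [seq z i | i <- enum 'I_N]) with
  | left h => learn S B eta1 eta2 G_gt0 K_gt0 N_gt0 (projT1 (cid h))
  | right _ => fun _ => true
  end.

Lemma learnerE (z : 'I_N -> X * R) k :
  learner k [seq z i | i <- enum 'I_N] = learn S B eta1 eta2 G_gt0 K_gt0 N_gt0 z.
Proof.
rewrite /learner; case: pselect => [h|]; last by case; exists z.
congr learn; case: cid => z' /= /eq_in_map e; apply/funext => i.
by rewrite e // mem_enum.
Qed.

(** The supremum over [B] need not be attained; a slack of [gam] provides a single [b] for the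
    analysis. *)
Lemma near_optimal (w : nat -> R) (p : nat -> X * R) :
  distXY w p -> B !=set0 -> exists2 b, B b & forall b', B b' ->
    expect w p (fun z => gprod z.2 (b' z.1)) - gam <= expect w p (fun z => gprod z.2 (b z.1)).
Proof.
move=> [w_dist y1] [b1 Bb1].
pose E := [set expect w p (fun z => gprod z.2 (b z.1)) | b in B].
have supE : has_sup E.
  split; first by exists (expect w p (fun z => gprod z.2 (b1 z.1))), b1.
  exists 1 => _ [b Bb <-].
  have := expect_truncate w_dist (g := fun z => gprod z.2 (b z.1)) (p := p) 0.
  rewrite big_ord0 subr0 /series /= big_geq // subr0 => h.
  apply: le_trans (ler_norm _) (h _) => i.
  have yi : `|(p i).2| <= 1 by rewrite ler_norml.
  rewrite /gprod; case Eb: (b _) => [v|]; last by rewrite normrN normr_id.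
  by rewrite normrM mulr_ile1 // ler_norml; apply: B_le1 Bb _ _ Eb.
have g0 : 0 < gam by case/andP: gam01.
have [_ [b Bb <-] hb] := sup_adherent g0 supE.
exists b => // b' Bb'; have : expect w p (fun z => gprod z.2 (b' z.1)) <= sup E.
  by apply: sup_upper_bound => //; exists b'.
by lra.
Qed.

Lemma CorM_existsI : CorM_exists N S B eps delta.
Proof.
exists (fun k => (k == 0%N)%:R), learner; split; first exact: ddist_dirac.
move=> w p dwp [s Ss s_mean]; have [w_dist y1] := dwp.
have w0 : forall i, 0 <= w i by case: w_dist.
have /andP [g0 g1] := gam01; have n0 : 0 < N%:R :> R by rewrite ltr0n.
(* The first bound serves the Chernoff estimate; the second makes all [N] draws fall below [M]
   except with probability [delta / 2]. The other half of [delta] pays for deviations. *)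
pose tau := Num.min (gam / 36) (delta / 2 / N%:R).
have tau0 : 0 < tau by rewrite lt_min !divr_gt0.
have [M hM] := ddist_truncation w_dist tau0.
apply: le_trans (@success_prob_ge _ _ N M w p _ _ _ w0 _); last by rewrite eqxx.
rewrite lee_fin.
have tau1 : tau <= gam / 36 by rewrite ge_min lexx.
have tau2 : N%:R * tau <= delta / 2.
  rewrite mulrC -ler_pdivlMr //; by rewrite ge_min lexx orbT.
have total : 1 - delta / 2 <= \sum_(u : {ffun 'I_N -> 'I_M}) prodw (fun i : 'I_M => w i) u.
  rewrite sum_prodw card_ord; have := @bernoulli _ tau N ltac:(lra).
  have : (1 - tau) ^+ N <= (\sum_(i < M) w i) ^+ N.
    apply: lerXn2r; rewrite ?nnegrE ?sumr_ge0 //; first by lra.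
    by move: hM; rewrite /series /= big_mkord.
  by lra.
pose good (u : {ffun 'I_N -> 'I_M}) :=
  corm_good B eps w p (learner 0 [seq p (u i) | i <- enum 'I_N]).
suff fail : \sum_(u : {ffun 'I_N -> 'I_M}) prodw (fun i : 'I_M => w i) u * (~~ good u)%:R <= delta / 2.
  have : \sum_(u : {ffun 'I_N -> 'I_M}) prodw (fun i : 'I_M => w i) u
    = \sum_(u : {ffun 'I_N -> 'I_M}) prodw (fun i : 'I_M => w i) u * (good u)%:R
     + \sum_(u : {ffun 'I_N -> 'I_M}) prodw (fun i : 'I_M => w i) u * (~~ good u)%:R.
    rewrite -big_split /=; apply: eq_bigr => u _.
    by case: (good u); rewrite /= mulr0 mulr1 ?addr0 ?add0r.
  by rewrite /good; lra.
(* For empty [B] the supremum is minus infinity and every output is good. *)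
have [B0|/set0P /(near_optimal dwp) [b Bb hb]] := eqVneq B set0.
  rewrite big1 ?divr_ge0 ?ltW // => u _.
  by rewrite /good /corm_good B0 image_set0 ereal_sup0 /= leNye mulr0.
have yn i : `|(p i).2| <= 1 by rewrite ler_norml.
have [k0 hk0] := exists_threshold M G_gt0 w_dist s_mean S_le1 B_le1 Ss Bb eta1_gt0 eta2_gt0.
apply: le_trans fail_small; apply: (learn_fail_prob (s := s) (b := b) (S := S) (B := B)
   (eta1 := eta1) (eta2 := eta2) w_dist yn gam01 (k0 := k0)); first by lra.
move=> u hu; have := learn_good G_gt0 K_gt0 N_gt0 w_dist yn s_mean S_le1 B_le1 Ss Bb vc gam01 K_large
  eta1_gt0 hk0 hu.
rewrite /good /corm_good (learnerE (sample p u)) => hl.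
rewrite leeBlDr // -EFinD; apply: ge_ereal_sup => _ [b' Bb' <-]; rewrite lee_fin.
(* The total is [6 * gam], plus [6 * tau <= gam / 6], plus [gam] for near-optimality, within
   [8 * gam]. *)
have := hb _ Bb'; move: hl eps_large; lra.
Qed.

End Existence.

(** * Elementary estimates for logarithms *)

Section LogBounds.
Variable R : realType.
Implicit Types x y q : R.

Lemma ln2_gt0 : 0 < ln 2 :> R.
Proof. by rewrite ln_gt0 // ltr1n. Qed.

Lemma ln2_le1 : ln 2 <= 1 :> R.
Proof.
have -> : 2 = 1 + 1 :> R by [].
by apply: le_ln1Dx; lra.
Qed.

Lemma le_ln x y : 0 < x -> x <= y -> ln x <= ln y.
Proof. by move=> x0 xy; rewrite ler_ln ?posrE // (lt_le_trans x0). Qed.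

Lemma ln_le_log2 x : 1 <= x -> ln x <= log2 x.
Proof.
move=> x1; have l0 := ln_ge0 x1; have p := ln2_gt0; have p1 := ln2_le1.
rewrite /log2 ler_pdivlMr //; exact: ler_piMr.
Qed.

Lemma log2_inv_ge1 x : 0 < x < 1 / 2 -> 1 <= log2 (1 / x).
Proof.
move=> /andP [x0 x2]; rewrite /log2 ler_pdivlMr ?ln2_gt0 // (mul1r (ln 2)) le_ln //.
by rewrite ler_pdivlMr //; lra.
Qed.

Lemma log2p_ge1 x : 1 <= log2p x.
Proof.
rewrite /log2p /log2 ler_pdivlMr ?ln2_gt0 // mul1r le_ln //.
by rewrite le_max lexx.
Qed.

(** Concavity: the tangent at [q]. It bounds [ln N] by a small multiple of [N], so that the
    condition on the sample size is not circular. *)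
Lemma ln_tangent x q : 0 < x -> 0 < q -> ln x <= ln q + x / q - 1.
Proof.
move=> x0 q0; have xq : 0 < x / q by rewrite divr_gt0.
have := @le_ln1Dx R (x / q - 1); rewrite addrCA subrr addr0 => h.
have : ln (x / q) <= x / q - 1 by apply: h; lra.
by rewrite ln_div ?posrE //; lra.
Qed.

Lemma log2p_mul5 x : 0 <= x -> log2p (5 * x) <= 4 * log2p x.
Proof.
move=> x0; have h1 := log2p_ge1 x.
have m2 : 2 <= Num.max 2 x by rewrite le_max lexx.
have : log2p (5 * x) <= log2p x + 3.
  have l8 : ln (2 ^+ 3) = 3 * ln 2 :> R by rewrite lnXn // mulr_natl.
  rewrite /log2p /log2 -lerBlDl -mulrBl ler_pdivrMr ?ln2_gt0 // -l8 lerBlDl.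
  rewrite -lnM ?posrE ?exprn_gt0 //; last by lra.
  have mx : x <= Num.max 2 x by rewrite le_max lexx orbT.
  rewrite le_ln // ?lt_max ?ltr0n //.
  by rewrite ge_max; apply/andP; split; lra.
by lra.
Qed.

End LogBounds.

(** * Comparison with the fat-shattering dimension *)

Lemma fat_shatters_bin (R : realType) (X : Type) (H : set (X -> option R)) (r : X -> R) (eta : R)
    (X' : seq X) : shatters (bin_class H r eta) X' -> fat_shatters H eta X'.
Proof.
move=> sh; exists r => xi; have [_ [h Hh <-] e] := sh xi; exists h => // x /e.
rewrite /binarize; case: (h x) => // v hv; exists v; split=> //; move: hv.
case: ltP => h1; first by case=> <- /=; lra.
by case: ltP => // h2 [<-] /=; lra.
Qed.

Lemma supVC_le_fat (R : realType) (X : Type) (S B : set (X -> option R)) (eta : R) :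
  (supVC S B eta eta <= fat S B eta)%E.
Proof.
apply: ge_ereal_sup => _ [theta _ <-]; apply: ge_ereal_sup => _ [X' [nd [sS sB]] <-].
by apply: ereal_sup_ubound; exists X' => //; split=> //; split; apply: fat_shatters_bin; eassumption.
Qed.

(** * Choice of the numbers of thresholds, points and samples *)

Lemma fail_bound (R : realType) (r K N : nat) (delta : R) :
  (0 < r)%N -> (0 < K)%N -> (0 < N)%N -> 0 < delta ->
  72 * r%:R ^+ 2 * (ln (3 * r%:R * K%:R) + K%:R * ln (72 * K%:R * r%:R ^+ 2) 
                   + K%:R * ln 2 - ln (delta / 2)) <= N%:R ->
  (3 * r * K * N ^ K * 2 ^ K)%:R * expR (K%:R - (1 / r%:R) ^+ 2 * N%:R / 36) <= delta / 2.
Proof.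
move=> r0 K0 N0 d0 hN.
have r0' : 0 < r%:R :> R by rewrite ltr0n.
have K0' : 0 < K%:R :> R by rewrite ltr0n.
have N0' : 0 < N%:R :> R by rewrite ltr0n.
have rK : 0 < 3 * r%:R * K%:R :> R by rewrite !mulr_gt0.
have q0 : 0 < 72 * K%:R * r%:R ^+ 2 :> R by rewrite !mulr_gt0 ?exprn_gt0.
have e1 : (3 * r * K * N ^ K * 2 ^ K)%:R
    = expR (ln (3 * r%:R * K%:R) + ln N%:R * K%:R + ln 2 * K%:R) :> R.
  by rewrite !expRD !expRM_natr !lnK ?posrE // !natrM !natrX.
rewrite e1 -expRD -[leRHS]lnK ?posrE ?divr_gt0 // ler_expR.
(* At this [q], [K * ln N] costs half of the exponent [N / (36 * r ^+ 2)], and the [- K] cancels the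
   [K] in the exponent. The other half pays for the remaining terms. *)
have h := ln_tangent N0' q0.
have h2 : ln N%:R * K%:R <=
    K%:R * ln (72 * K%:R * r%:R ^+ 2) + N%:R / (72 * r%:R ^+ 2) - K%:R :> R.
  have {h} h := ler_wpM2l (ltW K0') h.
  have -> : N%:R / (72 * r%:R ^+ 2) = K%:R * (N%:R / (72 * K%:R * r%:R ^+ 2)) :> R.
    by field; rewrite !gt_eqF.
  by lra.
have -> : (1 / r%:R) ^+ 2 * N%:R / 36 = 2 * (N%:R / (72 * r%:R ^+ 2)) :> R.
  by field; rewrite gt_eqF.
move: hN; rewrite mulrC -ler_pdivlMr ?mulr_gt0 ?exprn_gt0 //; lra.
Qed.

Lemma patterns_cost (R : realType) (beta : R) (m r K : nat) :
  0 < beta < 1 / 2 -> (0 < r)%N -> r%:R <= 17 / beta -> K = (16 * m * r ^ 2).+1 ->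
  K%:R * ln (72 * K%:R * r%:R ^+ 2)
    <= 544 * m%:R * r%:R ^+ 2 * (log2p (m%:R / beta)) ^+ 2 + 72 * r%:R ^+ 2.
Proof.
move=> /andP [b0 b2] r0 hr eK.
have r1 : 1 <= r%:R :> R by rewrite ler1n.
have r2 : 1 <= r%:R ^+ 2 :> R by rewrite exprn_ege1.
(* For [m = 0] the first summand vanishes and [K = 1]; the second summand covers this case. *)
have [m0|m0] := posnP m.
  rewrite eK m0 muln0 mul0n mulr0 !mul0r add0r mulr1 mul1r.
  by apply/ltW/ln_sublinear; rewrite mulr_gt0 // (lt_le_trans ltr01).
have m1 : 1 <= m%:R :> R by rewrite ler1n.
set L := log2p _; have L1 : 1 <= L := log2p_ge1 _.
have hK : K%:R <= 17 * m%:R * r%:R ^+ 2 :> R.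
  rewrite eK -natr1 natrM natrX natrM.
  have : 1 <= m%:R * r%:R ^+ 2 :> R by apply: mulr_ege1.
  by lra.
pose A := m%:R / beta.
have A0 : 0 < A by rewrite divr_gt0 // (lt_le_trans ltr01).
have A2 : 2 <= A by rewrite ler_pdivlMr //; lra.
have lnA : ln A <= L.
  apply: le_trans (ln_le_log2 _) _; first by lra.
  rewrite /L /log2p -/A; suff -> : Num.max 2 A = A by [].
  by apply/max_idPr.
have rA : r%:R <= 17 * A.
  apply: (le_trans hr); rewrite /A mulrA ler_pM2r ?invr_gt0 //; lra.
have mA : m%:R <= A by rewrite ler_pdivlMr // ler_piMr //; lra.
have K1 : 1 <= K%:R :> R by rewrite eK ler1n.
(* Everything is a power of [A = m / beta], and [72 * 17 ^ 5 <= 2 ^ 27]; the logarithm is then at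
   most [27 + 5 * L <= 32 * L]. *)
have big : 72 * K%:R * r%:R ^+ 2 <= 2 ^+ 27 * A ^+ 5.
  apply: (@le_trans _ _ (72 * (17 * A * (17 * A) ^+ 2) * (17 * A) ^+ 2)).
    apply: ler_pM; rewrite ?mulr_ge0 ?sqr_ge0 //; last by rewrite lerXn2r ?nnegrE //; lra.
    rewrite ler_pM2l //; apply: (le_trans hK); apply: ler_pM; rewrite ?mulr_ge0 ?sqr_ge0 //.
      by rewrite ler_pM2l.
    by rewrite lerXn2r ?nnegrE //; lra.
  have -> : 72 * (17 * A * (17 * A) ^+ 2) * (17 * A) ^+ 2 = 72 * 17 ^+ 5 * A ^+ 5 by ring.
  by rewrite ler_pM2r ?exprn_gt0 //; lra.
have hln : ln (72 * K%:R * r%:R ^+ 2) <= 32 * L.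
  apply: le_trans (le_ln _ big) _; first by rewrite !mulr_gt0 //; lra.
  rewrite lnM ?posrE ?exprn_gt0 // !lnXn // -[ln 2 *+ _]mulr_natl -[ln A *+ _]mulr_natl.
  by have := @ln2_le1 R; lra.
have L2 : L <= L ^+ 2 by rewrite expr2 ler_peMl //; lra.
apply: (@le_trans _ _ (17 * m%:R * r%:R ^+ 2 * (32 * L))).
  apply: ler_pM => //; apply: ln_ge0.
  by apply: mulr_ege1 => //; lra.
have : 0 <= m%:R * r%:R ^+ 2 * (L ^+ 2 - L) by rewrite mulr_ge0 ?mulr_ge0 ?sqr_ge0 ?subr_ge0.
by lra.
Qed.

Lemma sample_size (R : realType) (beta : R) (m : nat) (delta : R) :
  0 < beta < 1 / 2 -> 0 < delta < 1 / 2 ->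
  exists r K N : nat, [/\ (0 < r)%N, (0 < K)%N & (0 < N)%N] /\
   [/\ 11 / r%:R <= beta, 16 * m%:R <= (1 / r%:R) ^+ 2 * K%:R :> R,
     (3 * r * K * N ^ K * 2 ^ K)%:R * expR (K%:R - (1 / r%:R) ^+ 2 * N%:R / 36) <= delta / 2 &
     N%:R <= 72 * 20 * 100 * 17 ^+ 4 * (m%:R / beta ^+ 4 * (log2p (m%:R / beta)) ^+ 2
                           + 1 / beta ^+ 4 * log2 (1 / delta))].
Proof.
move=> hb hd; have /andP [b0 b2] := hb; have /andP [d0 d2] := hd.
(* [r] serves both as the grid size and as [1 / gam], so the budget [3 / G + 8 * gam] becomes
   [11 / r]. *)
pose r := (Num.trunc (16 / beta)).+1.
have r0 : (0 < r)%N by [].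
have p0 : 0 <= 16 / beta by rewrite divr_ge0 // ltW.
have /andP [t1 t2] := truncn_itv p0.
have hr : r%:R <= 17 / beta.
  rewrite /r -natr1; have : 1 <= 1 / beta by rewrite ler_pdivlMr //; lra.
  by lra.
have r0' : 0 < r%:R :> R by rewrite ltr0n.
have r1 : 1 <= r%:R :> R by rewrite ler1n.
have r2 : 1 <= r%:R ^+ 2 :> R by rewrite exprn_ege1.
pose K := (16 * m * r ^ 2).+1.
have KE : K%:R = 16 * m%:R * r%:R ^+ 2 + 1 :> R by rewrite /K -natr1 natrM natrX natrM.
have K1 : 1 <= K%:R :> R by rewrite ler1n.
have cost := patterns_cost hb r0 hr (erefl K).
set c := K%:R * ln _ in cost; set L := log2p _ in cost *.
pose Y : R := ln (3 * r%:R * K%:R) + c + K%:R * ln 2 - ln (delta / 2).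
have q1 : 3 * r%:R * K%:R <= 72 * K%:R * r%:R ^+ 2 :> R.
  have : K%:R * r%:R <= K%:R * r%:R ^+ 2 :> R by rewrite ler_pM2l ?ler_eXnr //; lra.
  have : 0 <= K%:R * r%:R ^+ 2 :> R by rewrite mulr_ge0 ?sqr_ge0.
  by lra.
have q2 : 3 <= 3 * r%:R * K%:R :> R by rewrite -mulrA -[leLHS]mulr1 ler_pM2l // mulr_ege1.
have l1 : 0 <= ln (3 * r%:R * K%:R) :> R by apply: ln_ge0; lra.
have l3 : ln (3 * r%:R * K%:R) <= ln (72 * K%:R * r%:R ^+ 2) :> R by apply: le_ln => //; lra.
have lc : ln (72 * K%:R * r%:R ^+ 2) <= c by rewrite /c ler_peMl //; lra.
have c2 : K%:R * ln 2 <= c.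
  by rewrite /c ler_pM2l; [apply: le_ln => //|]; lra.
have ld : ln (delta / 2) = ln delta - ln 2 by rewrite ln_div ?posrE.
have ld1 : ln (1 / delta) = - ln delta by rewrite div1r lnV ?posrE.
have lg : ln (1 / delta) <= log2 (1 / delta).
  by apply: ln_le_log2; rewrite ler_pdivlMr //; lra.
have lg1 := log2_inv_ge1 hd; set l := log2 _ in lg lg1 *.
have lnl2 := @ln2_le1 R; have lng2 := @ln2_gt0 R.
have kl2 : 0 <= K%:R * ln 2 :> R by rewrite mulr_ge0 // ltW.
have ldn : ln delta <= 0 by apply: ln_le0; lra.
have Y0 : 0 <= Y by rewrite /Y; lra.
have YU : Y <= 3 * c + 1 + l by rewrite /Y; lra.
have z0 : 0 <= 72 * r%:R ^+ 2 * Y by rewrite mulr_ge0 ?mulr_ge0 ?sqr_ge0.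
have /andP [n1 n2] := truncn_itv z0.
pose N := (Num.trunc (72 * r%:R ^+ 2 * Y)).+1.
exists r, K, N; split; split=> //.
- rewrite ler_pdivrMr // mulrC -ler_pdivrMr //.
  by apply: le_trans (ltW t2); rewrite ler_pM2r ?invr_gt0 //; lra.
- rewrite expr_div_n expr1n div1r [leRHS]mulrC ler_pdivlMr ?exprn_gt0 // KE.
  by lra.
- by apply: fail_bound => //; apply: le_trans (ltW n2); rewrite -/c -/Y.
set P := m%:R * L ^+ 2; set Q : R := r%:R ^+ 2.
have P0 : 0 <= P by rewrite mulr_ge0 ?sqr_ge0.
have hN : N%:R <= 72 * 20 * 100 * (Q * Q) * (P + l).
  (* [1632] and [216] are three times the constants of [patterns_cost]. Since [Q] and [l] are at
     least one, [Q * Q * (P + l)] dominates every term up to the generous constant. *)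
  have YU' : Y <= 1632 * (P * Q) + 216 * Q + 1 + l.
    by apply: (le_trans YU); move: cost; rewrite /P /Q; lra.
  have Q0 : 0 <= Q by exact: sqr_ge0.
  have QQ1 : 1 <= Q := r2.
  have q : Q * Y <= Q * (1632 * (P * Q) + 216 * Q + 1 + l) by apply: ler_wpM2l.
  have QQ : Q <= Q * Q by apply: ler_peMr.
  have QQ0 : 0 <= Q * Q by apply: mulr_ge0.
  have QQl : Q * Q <= Q * Q * l by apply: ler_peMr.
  have Ql : Q * l <= Q * Q * l by apply: ler_wpM2r => //; apply: le_trans lg1.
  have QP : 0 <= Q * Q * P by apply: mulr_ge0.
  rewrite /N -natr1; rewrite -/Q in n1; lra.
apply: (le_trans hN).
have -> : m%:R / beta ^+ 4 * L ^+ 2 + 1 / beta ^+ 4 * l = (P + l) / beta ^+ 4.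
  by rewrite /P; field; rewrite gt_eqF.
have hQ : Q * Q <= (17 / beta) ^+ 4.
  have -> : Q * Q = r%:R ^+ 4 by rewrite /Q -exprD.
  by rewrite lerXn2r ?nnegrE // divr_ge0 // ltW.
have -> : 72 * 20 * 100 * 17 ^+ 4 * ((P + l) / beta ^+ 4) = 72 * 20 * 100 * (17 / beta) ^+ 4 * (P + l).
  by rewrite expr_div_n; ring.
apply: ler_wpM2r; first by apply: addr_ge0 => //; apply: le_trans lg1.
have k0 : 0 <= 72 * 20 * 100 :> R by rewrite !mulr_ge0.
exact: ler_wpM2l k0 _ _ hQ.
Qed.

(** * Assembly of the two sample bounds *)

Lemma CorM_bound (R : realType) (X : Type) (S B : set (X -> option R)) (eta1 eta2 beta delta : R)
    (m : nat) :
  real_valued_class S -> real_valued_class B ->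
  0 < eta1 -> 0 < eta2 -> 0 < beta < 1 / 2 -> 0 < delta < 1 / 2 ->
  (supVC S B eta1 eta2 <= (m%:R)%:E)%E ->
  exists n : nat,
    n%:R <= 72 * 20 * 100 * 17 ^+ 4 * (m%:R / beta ^+ 4 * (log2p (m%:R / beta)) ^+ 2
                           + 1 / beta ^+ 4 * log2 (1 / delta))
    /\ CorM_exists n S B (beta + 2 * eta1 + 2 * eta2) delta.
Proof.
move=> hS hB e1 e2 hb hd vc.
have [r [K [N [[r0 K0 N0] [hr hK hf hN]]]]] := sample_size m hb hd.
have r0' : 0 < r%:R :> R by rewrite ltr0n.
exists N; split=> //; apply: (CorM_existsI (gam := 1 / r%:R) r0 K0 N0 hS hB vc) => //.
- by rewrite divr_gt0 // ler_pdivrMr // mul1r ler1n.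
- by case/andP: hd.
- by lra.
Qed.

Theorem theorem4p4 :
  exists C : nat,
  forall (R : realType) (X : Type) (S B : set (X -> option R)),
    real_valued_class S -> real_valued_class B ->
    (forall eta1 eta2 beta delta : R,
       0 < eta1 < 1/2 -> 0 < eta2 < 1/2 -> 0 < beta < 1/2 -> 0 < delta < 1/2 ->
       forall m : nat, (supVC S B eta1 eta2 <= (m%:R)%:E)%E ->
       exists n : nat,
         n%:R <= C%:R * (m%:R / beta ^+ 4 * (log2p (m%:R / beta)) ^+ 2 * log2 (1 / eta1)
                         + 1 / beta ^+ 4 * log2 (1 / eta1) * log2 (1 / delta)
                         + 1 / beta ^+ 2 * log2 (1 / eta2))
         /\ CorM_exists n S B (beta + 2 * eta1 + 2 * eta2) delta)
    /\
    (forall eps delta : R,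
       0 < eps < 1/2 -> 0 < delta < 1/2 ->
       (supVC S B (eps / 5) (eps / 5) <= fat S B (eps / 5))%E /\
       forall m : nat, (supVC S B (eps / 5) (eps / 5) <= (m%:R)%:E)%E ->
       exists n : nat,
         n%:R <= C%:R * (m%:R / eps ^+ 4 * (log2p (m%:R / eps)) ^+ 2 * log2 (1 / eps)
                         + 1 / eps ^+ 4 * log2 (1 / eps) * log2 (1 / delta))
         /\ CorM_exists n S B eps delta).
Proof.
(* The factor [100 ^+ 2] is [5 ^ 4 * 4 ^ 2]: replacing [eps / 5] by [eps] costs [625] in the fourth
   power and [16] in the squared logarithm. *)
have [c cE] : exists c : nat, forall R : realType,
    c%:R = 100 ^+ 2 * (72 * 20 * 100 * 17 ^+ 4) :> R.
  by exists (100 * 100 * (72 * 20 * 100 * (17 * 17 * 17 * 17)))%N => R; rewrite !natrM; ring.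
exists c => R X S B hS hB.
have c0E : 0 <= 72 * 20 * 100 * 17 ^+ 4 :> R by rewrite !mulr_ge0 ?exprn_ge0.
have {cE} := cE R; set c0 := 72 * 20 * 100 * 17 ^+ 4 in c0E * => cE.
split.
  move=> eta1 eta2 beta delta h1 h2 hb hd m vc.
  have [e1 _] := andP h1; have [e2 _] := andP h2; have [b0 _] := andP hb.
  have [n [hn hC]] := CorM_bound hS hB e1 e2 hb hd vc.
  exists n; split=> //; apply: (le_trans hn); rewrite -/c0 cE [100 ^+ 2 * c0]mulrC -(mulrA c0).
  apply: ler_wpM2l => //.
  have l1 := log2_inv_ge1 h1; have l2 := log2_inv_ge1 h2; have ld := log2_inv_ge1 hd.
  set P := m%:R / beta ^+ 4 * _ ^+ 2; set Q := 1 / beta ^+ 4; set Z := 1 / beta ^+ 2.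
  have P0 : 0 <= P by rewrite mulr_ge0 ?sqr_ge0 // divr_ge0 // exprn_ge0 // ltW.
  have Q0 : 0 <= Q by rewrite divr_ge0 // exprn_ge0 // ltW.
  have Z0 : 0 <= Z * log2 (1 / eta2).
    by apply: mulr_ge0; [rewrite divr_ge0 // sqr_ge0 | apply: le_trans l2].
  (* All parameters are below [1 / 2], so these logarithms are at least one and multiplying by them
     only enlarges the bound. *)
  have hP : P <= P * log2 (1 / eta1) by rewrite ler_peMr.
  have hQ : Q * log2 (1 / delta) <= Q * log2 (1 / eta1) * log2 (1 / delta).
    by apply: ler_wpM2r; [apply: le_trans ld | rewrite ler_peMr].
  have QL : 0 <= Q * log2 (1 / delta) by apply: mulr_ge0 => //; apply: le_trans ld.
  by lra.
move=> eps delta he hd; split; first exact: supVC_le_fat.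
move=> m vc; have [e0 e2] := andP he.
have e5 : 0 < eps / 5 by rewrite divr_gt0.
have hb : 0 < eps / 5 < 1 / 2 by rewrite e5 /=; lra.
have [n [hn]] := CorM_bound hS hB e5 e5 hb hd vc.
have -> : eps / 5 + 2 * (eps / 5) + 2 * (eps / 5) = eps by field.
move=> hC; exists n; split=> //; apply: (le_trans hn); rewrite -/c0 cE [100 ^+ 2 * c0]mulrC -(mulrA c0).
apply: ler_wpM2l => //.
have l1 := log2_inv_ge1 he; have ld := log2_inv_ge1 hd.
have hL : log2p (m%:R / (eps / 5)) <= 4 * log2p (m%:R / eps).
  rewrite (_ : m%:R / (eps / 5) = 5 * (m%:R / eps)); last by field; rewrite gt_eqF.
  by apply: log2p_mul5; rewrite divr_ge0 // ltW.
have L1 := log2p_ge1 (m%:R / (eps / 5)); have L2 := log2p_ge1 (m%:R / eps).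
have hL2 : log2p (m%:R / (eps / 5)) ^+ 2 <= 16 * log2p (m%:R / eps) ^+ 2.
  have -> : 16 * log2p (m%:R / eps) ^+ 2 = (4 * log2p (m%:R / eps)) ^+ 2 by move: (log2p _) => L; ring.
  by rewrite lerXn2r ?nnegrE //; lra.
set P := m%:R / eps ^+ 4 * log2p (m%:R / eps) ^+ 2; set Q := 1 / eps ^+ 4.
have k0 : 0 <= m%:R / eps ^+ 4 by rewrite divr_ge0 ?exprn_ge0 // ltW.
have P0 : 0 <= P by rewrite mulr_ge0 ?sqr_ge0.
have Q0 : 0 <= Q by rewrite divr_ge0 ?exprn_ge0 // ltW.
have hP : P <= P * log2 (1 / eps) by rewrite ler_peMr.
have hQ : Q * log2 (1 / delta) <= Q * log2 (1 / eps) * log2 (1 / delta).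
  by apply: ler_wpM2r; [apply: le_trans ld | rewrite ler_peMr].
have QL : 0 <= Q * log2 (1 / delta) by apply: mulr_ge0 => //; apply: le_trans ld.
have e1 : m%:R / (eps / 5) ^+ 4 * log2p (m%:R / (eps / 5)) ^+ 2 <= 100 ^+ 2 * P.
  have -> : m%:R / (eps / 5) ^+ 4 = 625 * (m%:R / eps ^+ 4) by field; rewrite gt_eqF.
  have := ler_wpM2l k0 hL2; rewrite /P; lra.
have e3 : 1 / (eps / 5) ^+ 4 = 625 * Q by rewrite /Q; field; rewrite gt_eqF.
by rewrite e3; lra.
Qed.
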